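(* Let $O\subset\mathbb{R}^d$ be a non-empty Greenian open set, and let $\vartheta,\mu$ be charges on $O$ with compact supports in $O$ such that $\mu$ is a balayage of $\vartheta$ for $\operatorname{har}(O)$. Then $$\int h\,d\vartheta=\int h\,d\mu\quad\text{for every } h\in\operatorname{har}\bigl(\operatorname{hull-in}_O(\operatorname{supp}\mu\cup\operatorname{supp}\vartheta)\bigr).$$
   Context: $d\ge1$. A charge is a Borel (Radon) signed measure; charges with compact support are finite. An open set is Greenian if it possesses a Green function (equivalently, each of its connected components carries a non-constant positive superharmonic function). $\operatorname{har}(O)$ is the class of harmonic functions on the open set $O$ (locally affine if $d=1$). For an arbitrary set $S$, $\operatorname{har}(S)$ is the class of restrictions to $S$ of functions harmonic on some open set (depending on the function) containing $S$. Balayage: for charges $\vartheta,\mu$ on $O$ and a class $H$ of Borel functions on $O$ whose integrals against $\vartheta$ and $\mu$ are well defined with values in $[-\infty,+\infty]$, $\mu$ is a balayage of $\vartheta$ for $H$ if $\int h\,d\vartheta\le\int h\,d\mu$ for all $h\in H$. Inward-filled hull: for a subset $K\subset O$, $\operatorname{hull-in}_O K$ is the union of $K$ with all connected components $C$ of $O\setminus K$ whose closure in $O$ is a compact subset of $O$. *)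

(* Defs.v *)
From HB Require Import structures.
From mathcomp Require Import all_boot all_order all_algebra.
From mathcomp Require Import all_classical all_reals all_analysis.

Set Implicit Arguments.
Unset Strict Implicit.
Unset Printing Implicit Defensive.

Import Order.TTheory GRing.Theory Num.Theory.
Import numFieldNormedType.Exports.

Local Open Scope classical_set_scope.
Local Open Scope ring_scope.

(* The library topology on 'rV[R]_d is that of the sup norm, i.e. the usual
   topology of R^d; metric notions go through [eucl_norm] below. *)

Section harmonic_functions.
Context {R : realType} {d : nat}.
Local Notation V := 'rV[R]_d.
Implicit Types (f h : V -> R) (O S K : set V).

Definition partial (i : 'I_d) f : V -> R := 'D_(delta_mx 0 i) f.

(* Of class C^k on an open set O; for O open this depends only on the
   values of f on O. *)
Fixpoint Ck_on (k : nat) O f : Prop :=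
  (forall x, O x -> {for x, continuous f}) /\
  if k is k'.+1 then
    forall i : 'I_d,
      (forall x, O x -> derivable f x (delta_mx 0 i)) /\ Ck_on k' O (partial i f)
  else True.

Definition laplacian f (x : V) : R := \sum_(i < d) partial i (partial i f) x.

(* har(O) for O open. For d = 1 this says f'' = 0, i.e. f is affine on each
   component of O. *)
Definition har_open O : set (V -> R) :=
  [set f | Ck_on 2 O f /\ forall x, O x -> laplacian f x = 0].

(* har(S) for an arbitrary set S: functions on S are represented by total
   functions of which only the values on S are meaningful. *)
Definition har S : set (V -> R) :=
  [set h | exists U, [/\ open U, S `<=` U &
     exists2 f, har_open U f & forall x, S x -> h x = f x]].

Definition eucl_norm (x : V) : R := Num.sqrt (\sum_(i < d) x 0 i ^+ 2).

(* -|x-y| for d = 1, -ln|x-y| for d = 2, |x-y|^(2-d) for d >= 3;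
   +oo on the diagonal when d >= 2. *)
Definition fundamental (x y : V) : \bar R :=
  let r := eucl_norm (x - y) in
  if d == 1%N then (- r)%:E
  else if x == y then +oo%E
  else if d == 2%N then (- ln r)%:E
  else ((r ^+ (d - 2)) ^-1)%:E.

(* G(., y) is the fundamental solution with pole y plus a harmonic function,
   and 0 is its greatest harmonic minorant on O. *)
Definition green_function O (G : V -> V -> \bar R) : Prop :=
  forall y, O y ->
    [/\ exists2 h, har_open O h &
          forall x, O x -> G x y = (fundamental x y + (h x)%:E)%E,
        forall x, O x -> (0 <= G x y)%E &
        forall u, har_open O u -> (forall x, O x -> ((u x)%:E <= G x y)%E) ->
          forall x, O x -> u x <= 0].

Definition greenian O : Prop := exists G, green_function O G.

(* The closure of C in the space O is [closure C `&` O]. *)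
Definition hull_in O K : set V :=
  K `|` \bigcup_(C in [set connected_component (O `\` K) x | x in O `\` K]
                      `&` [set C | compact (closure C `&` O)]) C.

End harmonic_functions.

(* R^d with its Borel sigma-algebra. *)
Notation borelRd R d := (g_sigma_algebraType (@open 'rV[R]_d)).

Section jordan.
Context d (T : measurableType d) (R : realType).
Variable nu : {charge set T -> \bar R}.

Definition hahn_pos : set T := sval (cid (Hahn_decomposition nu)).

Definition hahn_neg : set T :=
  sval (cid (svalP (cid (Hahn_decomposition nu)))).

Lemma hahn_pos_neg : hahn_decomposition nu hahn_pos hahn_neg.
Proof. exact: svalP (cid (svalP (cid (Hahn_decomposition nu)))). Qed.

(* The positive and negative parts of the Jordan decomposition do not depend
   on the chosen Hahn decomposition. *)
Definition charge_pos : {measure set T -> \bar R} := jordan_pos hahn_pos_neg.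

Definition charge_neg : {measure set T -> \bar R} := jordan_neg hahn_pos_neg.

Definition total_variation : set T -> \bar R := charge_variation hahn_pos_neg.

Definition charge_integral (D : set T) (h : T -> R) : \bar R :=
  (\int[charge_pos]_(x in D) (h x)%:E - \int[charge_neg]_(x in D) (h x)%:E)%E.

End jordan.

(* Charges of compact support on an open set O are finite; they are
   represented by their extensions by 0 to R^d, that is by the (finite)
   charges nu on R^d such that [charge_supp nu] is compact and included
   in O. *)
Section charges.
Context {R : realType} {d : nat}.
Local Notation V := 'rV[R]_d.

Definition charge_supp (nu : {charge set borelRd R d -> \bar R}) : set V :=
  [set x | forall U : set V, open U -> U x -> total_variation nu U != 0%E].

(* mu is a balayage of theta for a class H of functions on O. Meant for
   Borel functions whose integrals over O are well defined. For charges of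
   compact support in O this holds for H = har_open O, where all the
   integrals are finite. *)
Definition balayage (O : set V) (theta mu : {charge set borelRd R d -> \bar R}) (H : set (V -> R)) : Prop :=
  forall h, H h ->
    (charge_integral theta O h <= charge_integral mu O h)%E.

End charges.

(* Main.v *)
Require Import Defs.
From HB Require Import structures.
From mathcomp Require Import all_boot all_order all_algebra.
From mathcomp Require Import all_classical all_reals all_analysis.
From mathcomp Require Import measurable_realfun ring lra.

Set Implicit Arguments.
Unset Strict Implicit.
Unset Printing Implicit Defensive.

Import Order.TTheory GRing.Theory Num.Theory.
Import numFieldNormedType.Exports.

Local Open Scope classical_set_scope.
Local Open Scope ring_scope.

(* The signed measure [mu - theta] annihilates har(O), because har(O) is stable
   under negation. Let p be its potential with respect to the fundamental
   solution E. At a pole z outside O all directional derivatives of E(. - z) are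
   harmonic on O, so the Taylor expansion of p at z vanishes, and likewise far
   away through the expansion of E(x - y) in harmonic polynomials of x. By
   analyticity on lines p vanishes on every component of the complement of the
   supports which is unbounded or touches the complement of O, hence off the
   hull L. Replace E by a C^2 kernel equal to E outside a small ball and with
   nonnegative Laplacian psi carried by that ball: the regularized potential
   vanishes off a neighbourhood of L, and pairing it with the Laplacian of a
   function f harmonic near L shows that [mu - theta] annihilates f * psi, which
   is nearly a constant multiple of f on the supports. The pairing is carried
   out with finite lattice sums and second differences, so that no integration
   over R^d is needed. *)

(** * Derivatives of the fundamental solution *)

Section directional_derivatives.
Context {R : realType} {V : normedModType R}.
Implicit Types (f g : V -> R) (x v : V).

(** The argument is the dual form of a Runge theorem: nothing is extended to [O] or approximated
    there, only the annihilating functional is tested. It enters solely through the record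
    [annihilates], so every limit must be an estimate uniform on [K] followed by one use of the
    bound of the functional, and every sum passed through it must be finite. Hence one-variable
    Taylor formulas with explicit remainder along segments, and lattice sums in place of
    convolutions. The kernel is regularized because the potential itself is uncontrolled near [K],
    where the fundamental solution may be singular. The pairing is small because at each lattice
    point one factor is: at distance at least [e] from the hull the regularized potential is zero,
    and closer to it the second difference of [f] is small by harmonicity. The cutoff of [f] may
    therefore jump. Parameters are chosen in the order: oscillation [w] of [f], radius [e] of the
    kernel, accuracy [s], mesh [h]; the constants multiplying [s] depend neither on [s] nor on
    [h]. *)

Lemma is_derive_lineP f x v (l : R) :
  is_derive x v f l <-> is_derive (0 : R) 1 (fun t => f (t *: v + x)) l.
Proof.
have E : 'D_1 (fun t : R => f (t *: v + x)) 0 = 'D_v f x.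
  rewrite /derive; set g1 := fun h => h^-1 *: _; set g2 := fun h => h^-1 *: _.
  suff -> : g1 = g2 by [].
  by apply/funext => h; rewrite /g1 /g2/= addr0 scale0r add0r [_%:A]mulr1.
split=> -[df dl]; split; rewrite -?dl ?E//.
  by have [+ _] := derivable1P f x v; apply.
by have [_ +] := derivable1P f x v; apply.
Qed.

Lemma is_derive_comp1 (g : R -> R) f x v (a b : R) :
  is_derive (f x) 1 g a -> is_derive x v f b ->
  is_derive x v (fun y => g (f y)) (a * b).
Proof.
move=> dg /is_derive_lineP df; apply/is_derive_lineP.
have := @is_derive1_comp R g (fun t => f (t *: v + x)) 0 a b.
by rewrite scale0r add0r; apply.
Qed.

Lemma is_derive_add f g x v (a b : R) :
  is_derive x v f a -> is_derive x v g b ->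
  is_derive x v (fun y => f y + g y) (a + b).
Proof. by move=> df dg; apply: is_deriveD. Qed.

Lemma is_derive_mul f g x v (a b : R) :
  is_derive x v f a -> is_derive x v g b ->
  is_derive x v (fun y => f y * g y) (a * g x + f x * b).
Proof.
by move=> df dg; rewrite addrC [a * _]mulrC; apply: is_deriveM.
Qed.

Lemma is_derive_bigsum (I : Type) (s : seq I) (F : I -> V -> R) x v (a : I -> R) :
  (forall i, is_derive x v (F i) (a i)) ->
  is_derive x v (fun y => \sum_(i <- s) F i y) (\sum_(i <- s) a i).
Proof.
move=> dF; elim: s => [|i s IHs].
  rewrite big_nil; under eq_fun do rewrite big_nil; exact: is_derive_cst.
rewrite big_cons; under eq_fun do rewrite big_cons.
exact: is_derive_add.
Qed.

Lemma is_derive_near_unique f g x v (a b : R) : (\forall y \near x, f y = g y) ->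
  is_derive x v f a -> is_derive x v g b -> a = b.
Proof.
move=> fg df [_ <-]; have [_ <-] := near_eq_is_derive fg df.
by [].
Qed.

End directional_derivatives.

Lemma near_continuous {R : realType} (T : topologicalType) (f g : T -> R) (x : T) :
  (\forall y \near x, f y = g y) ->
  {for x, continuous f} -> {for x, continuous g}.
Proof.
move=> fg; rewrite /prop_for /continuous_at -(nbhs_singleton fg) => cf.
apply: cvg_trans cf; apply: (@near_eq_cvg _ _ (nbhs x)).
exact: fg.
Qed.

Lemma continuous_sum_at {R : realType} (T : topologicalType) (I : Type)
    (s : seq I) (F : I -> T -> R) (x : T) :
  (forall i, {for x, continuous (F i)}) ->
  {for x, continuous (fun y => \sum_(i <- s) F i y)}.
Proof.
move=> cF; elim: s => [|i s IHs]; rewrite /prop_for /continuous_at.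
  by under eq_fun do rewrite big_nil; rewrite big_nil; exact: cst_continuous.
under eq_fun do rewrite big_cons.
by rewrite big_cons; apply: (@continuousD R R^o T (F i)); [exact: cF | exact: IHs].
Qed.

Section fundamental_solution.
Context {R : realType} {d : nat}.
Local Notation V := 'rV[R]_d.
Implicit Types (u v w x y z : V).

Definition dot u v : R := \sum_i u 0 i * v 0 i.

Lemma dotC u v : dot u v = dot v u.
Proof. by apply: eq_bigr => i _; rewrite mulrC. Qed.

Lemma dotDl u v w : dot (u + v) w = dot u w + dot v w.
Proof. by rewrite -big_split; apply: eq_bigr => i _; rewrite mxE mulrDl. Qed.

Lemma dotZl a u v : dot (a *: u) v = a * dot u v.
Proof. by rewrite mulr_sumr; apply: eq_bigr => i _; rewrite mxE mulrA. Qed.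

Lemma dot_delta u i : dot u (delta_mx 0 i) = u 0 i.
Proof.
rewrite /dot (bigD1 i)//= mxE !eqxx mulr1 big1 ?addr0// => j ji.
by rewrite mxE eqxx (negbTE ji) mulr0.
Qed.

Lemma norm_coord x i : `|x 0 i| <= `|x|.
Proof.
rewrite [leRHS]/Num.Def.normr/= mx_normrE.
exact: (le_bigmax _ (fun ij : 'I_1 * 'I_d => `|x ij.1 ij.2|) (0, i)).
Qed.

Lemma norm_le_coord x (e : R) :
  0 <= e -> (forall i, `|x 0 i| <= e) -> `|x| <= e.
Proof.
move=> e0 xe; rewrite [leLHS]/Num.Def.normr/= mx_normrE bigmax_le// => -[i j] _.
by rewrite /= ord1.
Qed.

Lemma norm_lt_coord x (e : R) :
  0 < e -> (forall i, `|x 0 i| < e) -> `|x| < e.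
Proof.
move=> e0 xe; rewrite [ltLHS]/Num.Def.normr/= mx_normrE bigmax_lt// => -[i j] _.
by rewrite /= ord1.
Qed.

Lemma dot_le_norm u v : `|dot u v| <= d%:R * (`|u| * `|v|).
Proof.
apply: (le_trans (ler_norm_sum _ _ _)).
apply: (@le_trans _ _ (\sum_(i < d) `|u| * `|v|)).
  by apply: ler_sum => i _; rewrite normrM ler_pM ?norm_coord.
by rewrite sumr_const card_ord mulr_natl.
Qed.

(** The norm of ['rV[R]_d] is the sup norm while [rho] is Euclidean; with [dot_le_norm] this lets
    the Euclidean kernel be estimated on sup-norm balls. *)
Lemma norm_le_dot x : `|x| ^+ 2 <= dot x x.
Proof.
have dx0 : 0 <= dot x x by apply: sumr_ge0 => i _; rewrite -expr2 sqr_ge0.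
suff : `|x| <= Num.sqrt (dot x x).
  by move=> h; rewrite -(sqr_sqrtr dx0) ler_pXn2r// nnegrE ?sqrtr_ge0.
apply: norm_le_coord => [|i]; first exact: sqrtr_ge0.
rewrite -sqrtr_sqr ler_wsqrtr// /dot (bigD1 i)//= expr2 lerDl sumr_ge0//.
by move=> j _; rewrite -expr2 sqr_ge0.
Qed.

Lemma dot_gt0 x : x != 0 -> 0 < dot x x.
Proof.
move=> x0; apply: lt_le_trans (norm_le_dot x).
by rewrite exprn_gt0// normr_gt0.
Qed.

Lemma is_derive_coord x v i : is_derive x v (fun y => y 0 i : R) (v 0 i).
Proof.
apply/is_derive_lineP; under eq_fun do rewrite mxE [X in X + _]mxE mulrC.
have : is_derive (0 : R) 1 (fun t : R => v 0 i * t + x 0 i) (v 0 i * 1 + 0).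
  by apply: is_derive_add.
by rewrite mulr1 addr0.
Qed.

Lemma is_derive_dot x u v : is_derive x u (fun y => dot y v) (dot u v).
Proof.
apply: is_derive_bigsum => i.
have := @is_derive_mul R V (fun y => y 0 i) (fun=> v 0 i) x u _ 0
  (is_derive_coord x u i) (is_derive_cst _ _ _).
by rewrite mulr0 addr0.
Qed.

Lemma is_derive_sqnorm x u : is_derive x u (fun y => dot y y) (2 * dot x u).
Proof.
rewrite /dot mulr_sumr; apply: is_derive_bigsum => i.
have := is_derive_mul (is_derive_coord x u i) (is_derive_coord x u i).
by rewrite [X in X + _]mulrC -mulr2n mulr_natl.
Qed.

Lemma continuous_dot v : continuous (fun y => dot y v).
Proof.
move=> x; apply: continuous_sum_at => i.
apply: continuousM; last exact: cst_continuous.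
exact: coord_continuous.
Qed.

Lemma continuous_sqnorm : continuous (fun y => dot y y).
Proof.
move=> x; apply: continuous_sum_at => i.
by apply: continuousM; exact: coord_continuous.
Qed.

Definition rho x : R := Num.sqrt (dot x x).

Lemma rho_gt0 x : x != 0 -> 0 < rho x.
Proof. by move=> x0; rewrite sqrtr_gt0 dot_gt0. Qed.

Lemma sqr_rho x : rho x ^+ 2 = dot x x.
Proof.
by rewrite sqr_sqrtr//; apply: sumr_ge0 => i _; rewrite -expr2 sqr_ge0.
Qed.

Lemma is_derive_rho x v : x != 0 -> is_derive x v rho (dot x v / rho x).
Proof.
move=> x0.
have := @is_derive_comp1 R V Num.sqrt (fun y => dot y y) x v _ _
  (is_derive1_sqrt (dot_gt0 x0)) (is_derive_sqnorm x v).
congr is_derive; rewrite invfM -/(rho x); field.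
by rewrite gt_eqF ?rho_gt0.
Qed.

Lemma is_derive_invX (m : nat) (t : R) : 0 < t ->
  is_derive t 1 (fun s => s^-1 ^+ m) (- m%:R * t^-1 ^+ m.+1).
Proof.
move=> t0.
have dV : is_derive t 1 (fun s : R => s^-1) (- t ^- 2 *: 1).
  by apply: (@is_deriveV R id); rewrite ?gt_eqF.
have -> : (fun s : R => s^-1 ^+ m) = GRing.inv ^+ m by rewrite exprfctE.
apply: is_derive_eq (is_deriveX m dV) _; rewrite /GRing.scale /= mulr1.
case: m => [|m]; first by rewrite !(mul0r, oppr0).
by rewrite /= !exprS expr0 mulr1 invfM; ring.
Qed.

(* Primitive of [t^(1-d)]: the fundamental solution is [radial |x|], up to a
   multiplicative constant. *)
Definition radial (t : R) : R :=
  if d == 1%N then t else if d == 2%N then ln t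
  else - ((d - 2)%:R)^-1 * t^-1 ^+ (d - 2).

Lemma is_derive_radial (t : R) : (0 < d)%N -> 0 < t ->
  is_derive t 1 radial (t * t^-1 ^+ d).
Proof.
move=> hd t0; have tn0 : t != 0 by rewrite gt_eqF.
rewrite /radial; have [->|d1] := eqVneq d 1%N.
  by apply: is_derive_eq (is_derive_id _ _) _; rewrite expr1 divff.
have [->|d2] := eqVneq d 2%N.
  apply: is_derive_eq (is_derive1_ln t0) _.
  by rewrite expr2 mulrA divff// mul1r.
have [m dE] : exists m, d = m.+3.
  by case: (d) hd d1 d2 => [|[|[|m]]]// _ _ _; exists m.
rewrite dE subSS subSS subn0.
apply: is_derive_eq (is_deriveZ (- (m.+1%:R)^-1) (is_derive_invX m.+1 t0)) _.
rewrite /GRing.scale /= mulrA mulrNN mulVf ?pnatr_eq0// mul1r.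
by rewrite [in RHS]exprS mulrA divff// mul1r.
Qed.

(* Expressions closed under formal differentiation, so that the higher
   derivatives of the fundamental solution are available as functions and the
   symmetry of second derivatives is an algebraic identity;
   [Elin v] is [w |-> dot w v] and [Epow m] is [w |-> |w|^(-m)]. *)
Inductive expr :=
  | Ecst of R | Elin of V | Epow of nat | Efund
  | Eadd of expr & expr | Emul of expr & expr.

Fixpoint ev w (e : expr) : R :=
  match e with
  | Ecst c => c
  | Elin v => dot w v
  | Epow m => (rho w)^-1 ^+ m
  | Efund => radial (rho w)
  | Eadd a b => ev w a + ev w b
  | Emul a b => ev w a * ev w b
  end.

Fixpoint D v (e : expr) : expr :=
  match e with
  | Ecst _ => Ecst 0
  | Elin u => Ecst (dot v u)
  | Epow m => Emul (Ecst (- m%:R)) (Emul (Elin v) (Epow m.+2))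
  | Efund => Emul (Elin v) (Epow d)
  | Eadd a b => Eadd (D v a) (D v b)
  | Emul a b => Eadd (Emul (D v a) b) (Emul a (D v b))
  end.

(** Linearity in the direction makes iterated derivatives homogeneous polynomials of that direction;
    [taylorS] and [iterD_scale] rest on it. *)
Lemma D_linear w v e : ev w (D v e) = \sum_i v 0 i * ev w (D (delta_mx 0 i) e).
Proof.
have dotE u : dot v u = \sum_i v 0 i * dot (delta_mx 0 i) u.
  by apply: eq_bigr => i _; rewrite dotC dot_delta.
elim: e => [c|u|m||a IHa b IHb|a IHa b IHb] /=.
- by rewrite big1// => i _; rewrite mulr0.
- exact: dotE.
- rewrite dotC dotE mulr_suml mulr_sumr; apply: eq_bigr => i _.
  by rewrite (dotC w); ring.
- rewrite dotC dotE mulr_suml; apply: eq_bigr => i _.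
  by rewrite (dotC w); ring.
- by rewrite IHa IHb -big_split; apply: eq_bigr => i _; rewrite mulrDr.
- rewrite IHa IHb mulr_suml mulr_sumr -big_split; apply: eq_bigr => i _ /=.
  by ring.
Qed.

Lemma DC w u v e : ev w (D u (D v e)) = ev w (D v (D u e)).
Proof.
by elim: e => [c|z|m||a IHa b IHb|a IHa b IHb] //=;
  rewrite ?IHa ?IHb ?(dotC v u); ring.
Qed.

Context (hd : (0 < d)%N).

Lemma is_derive_ev w v e : w != 0 -> is_derive w v (ev^~ e) (ev w (D v e)).
Proof.
move=> w0; have r0 := rho_gt0 w0.
elim: e => [c|u|m||a IHa b IHb|a IHa b IHb] /=.
- exact: is_derive_cst.
- exact: is_derive_dot.
- have := is_derive_comp1 (is_derive_invX m r0) (is_derive_rho v w0).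
  by congr is_derive; rewrite !exprS; ring.
- have := is_derive_comp1 (is_derive_radial hd r0) (is_derive_rho v w0).
  congr is_derive; rewrite -[RHS]mul1r -(@divff _ (rho w)) ?gt_eqF//; ring.
- exact: is_derive_add.
- exact: is_derive_mul.
Qed.

Lemma continuous_ev w e : w != 0 -> {for w, continuous (ev^~ e)}.
Proof.
move=> w0; have r0 := rho_gt0 w0.
have cr : {for w, continuous rho}.
  apply: continuous_comp; first exact: continuous_sqnorm.
  exact: sqrt_continuous.
have comp1 (h : R -> R) l : is_derive (rho w) 1 h l ->
    {for w, continuous (fun y => h (rho y))}.
  move=> [dh _]; apply: continuous_comp => //.
  exact/differentiable_continuous/derivable1_diffP.
elim: e => [c|u|m||a IHa b IHb|a IHa b IHb] /=.
- exact: cst_continuous.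
- exact: continuous_dot.
- exact: comp1 (is_derive_invX m r0).
- exact: comp1 (is_derive_radial hd r0).
- exact: (@continuousD R R^o).
- exact: continuousM.
Qed.

Definition eqv e1 e2 := forall w, w != 0 -> ev w e1 = ev w e2.

Lemma near_neq0 w : w != 0 -> \forall y \near w, y != 0.
Proof.
move=> w0; near=> y; rewrite -normr_gt0.
have wy : `|w - y| < `|w| by near: y; apply: cvgr_dist_lt; rewrite ?normr_gt0.
apply: contraTT wy => /negP y0; rewrite -leNgt.
move: y0; rewrite normr_gt0 => /negP/negPn/eqP ->.
by rewrite subr0.
Unshelve. all: by end_near. Qed.

(** [D] acts on syntax, yet it respects equality of values: off the origin it computes the true
    derivative, and functions equal on an open set have equal derivatives there. *)
Lemma eqv_D v e1 e2 : eqv e1 e2 -> eqv (D v e1) (D v e2).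
Proof.
move=> e12 w w0; apply: is_derive_near_unique (is_derive_ev v e1 w0)
  (is_derive_ev v e2 w0).
by apply: filterS (near_neq0 w0) => y; exact: e12.
Qed.

Lemma eqv_iterD n v e1 e2 : eqv e1 e2 -> eqv (iter n (D v) e1) (iter n (D v) e2).
Proof. by move=> e12; elim: n => //= n; exact: eqv_D. Qed.

Lemma iterD_comm n u v e : eqv (D u (iter n (D v) e)) (iter n (D v) (D u e)).
Proof.
elim: n => //= n IHn w w0; rewrite DC; exact: eqv_D.
Qed.

Lemma iterD_add n v e1 e2 :
  iter n (D v) (Eadd e1 e2) = Eadd (iter n (D v) e1) (iter n (D v) e2).
Proof. by elim: n => //= n ->. Qed.

Lemma iterD_mulC n v c e : eqv (iter n (D v) (Emul (Ecst c) e))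
  (Emul (Ecst c) (iter n (D v) e)).
Proof.
elim: n e => // n IHn e w w0; rewrite !iterSr.
transitivity (ev w (iter n (D v) (Emul (Ecst c) (D v e)))); last exact: IHn.
by apply: eqv_iterD => // z z0 /=; rewrite mul0r add0r.
Qed.

Lemma iterD_cst0 n v : iter n (D v) (Ecst 0) = Ecst 0.
Proof. by elim: n => //= n ->. Qed.

Definition sumE (F : 'I_d -> expr) : expr := \big[Eadd/Ecst 0]_i F i.

Lemma ev_sumE w F : ev w (sumE F) = \sum_i ev w (F i).
Proof. by rewrite /sumE; elim/big_rec2 : _ => //= i _ y _ <-. Qed.

Lemma iterD_sumE n v F : iter n (D v) (sumE F) = sumE (fun i => iter n (D v) (F i)).
Proof.
rewrite /sumE; elim/big_rec2 : _ => [|i _ y _ <-]; first exact: iterD_cst0.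
exact: iterD_add.
Qed.

Definition lapE e := sumE (fun i => D (delta_mx 0 i) (D (delta_mx 0 i) e)).

Lemma lapE_iterD n v e : eqv (lapE (iter n (D v) e)) (iter n (D v) (lapE e)).
Proof.
move=> w w0; rewrite /lapE iterD_sumE !ev_sumE; apply: eq_bigr => i _.
by rewrite -iterD_comm//; apply: eqv_D => //; exact: iterD_comm.
Qed.

Lemma lapE_Fund : eqv (lapE Efund) (Ecst 0).
Proof.
move=> w w0; rewrite ev_sumE /=.
transitivity (\sum_(i < d) ((rho w)^-1 ^+ d
    - d%:R * (rho w)^-1 ^+ d.+2 * (w 0 i * w 0 i))).
  apply: eq_bigr => i _; rewrite !dot_delta mxE !eqxx mul1r.
  by congr (_ + _); ring.
rewrite sumrB sumr_const card_ord -mulr_sumr -/(dot w w) -sqr_rho !exprS.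
rewrite -mulr_natl; field.
by rewrite gt_eqF ?rho_gt0.
Qed.

Lemma lapE_iterD_Fund n v : eqv (lapE (iter n (D v) Efund)) (Ecst 0).
Proof.
move=> w w0; rewrite lapE_iterD// (eqv_iterD n v lapE_Fund)//.
by rewrite iterD_cst0.
Qed.

End fundamental_solution.

(** * Harmonic test functions *)

Section harmonic_tests.
Context {R : realType} {d : nat}.
Local Notation V := 'rV[R]_d.
Implicit Types (O : set V) (f g : V -> R) (u v w x y z : V).

Lemma open_near O x : open O -> O x -> \forall y \near x, O y.
Proof. by move=> oO Ox; apply: open_nbhs_nbhs. Qed.

Lemma Ck_on_ext k O f g : open O -> (forall x, O x -> f x = g x) ->
  Ck_on k O f -> Ck_on k O g.
Proof.
move=> oO; elim: k f g => [|k IHk] f g fg /= [cf df].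
  split => // x Ox; apply: near_continuous (cf _ Ox).
  by apply: filterS (open_near oO Ox) => y; exact: fg.
have nfg x : O x -> \forall y \near x, f y = g y.
  by move=> Ox; apply: filterS (open_near oO Ox) => y; exact: fg.
split=> [x Ox|i].
  by apply: near_continuous (cf _ Ox); exact: nfg.
have [di ci] := df i; split=> [x Ox|].
  by apply: near_eq_derivable (di _ Ox); exact: nfg.
by apply: IHk ci => x Ox; exact/near_eq_derive/nfg.
Qed.

(** [Ck_on] and [laplacian] speak of the iterated [partial]. Here candidate derivatives are supplied
    as functions, and openness of [O] transports continuity and differentiability from them to
    [partial]. *)
Lemma Ck_on_2I O f (f1 : 'I_d -> V -> R) (f2 : 'I_d -> 'I_d -> V -> R) :
  open O ->
  (forall x, O x -> {for x, continuous f}) ->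
  (forall i x, O x -> {for x, continuous (f1 i)}) ->
  (forall i j x, O x -> {for x, continuous (f2 i j)}) ->
  (forall i x, O x -> is_derive x (delta_mx 0 i) f (f1 i x)) ->
  (forall i j x, O x -> is_derive x (delta_mx 0 j) (f1 i) (f2 i j x)) ->
  Ck_on 2 O f /\ forall x, O x -> laplacian f x = \sum_i f2 i i x.
Proof.
move=> oO cf c1 c2 d1 d2.
have pf i x : O x -> f1 i x = partial i f x.
  by move=> Ox; apply/esym; apply: (@derive_val _ _ _ _ _ _ _ (d1 i x Ox)).
have pf1 i j x : O x -> f2 i j x = partial j (f1 i) x.
  by move=> Ox; apply/esym; apply: (@derive_val _ _ _ _ _ _ _ (d2 i j x Ox)).
split; last first.
  move=> x Ox; apply: eq_bigr => i _; rewrite pf1//.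
  apply/esym; apply: near_eq_derive; near=> y; apply: pf.
  near: y; exact: open_near.
split=> // i; split=> [x Ox|]; first by have [] := d1 i x Ox.
apply: (@Ck_on_ext _ _ (f1 i)) => //; first exact: pf.
split=> [x Ox|j]; first exact: c1.
split=> [x Ox|]; first by have [] := d2 i j x Ox.
apply: (@Ck_on_ext _ _ (f2 i j)) => //; first exact: pf1.
by split => // x Ox; exact: c2.
Unshelve. all: by end_near. Qed.

Lemma har_openI O f (f1 : 'I_d -> V -> R) (f2 : 'I_d -> 'I_d -> V -> R) :
  open O ->
  (forall x, O x -> {for x, continuous f}) ->
  (forall i x, O x -> {for x, continuous (f1 i)}) ->
  (forall i j x, O x -> {for x, continuous (f2 i j)}) ->
  (forall i x, O x -> is_derive x (delta_mx 0 i) f (f1 i x)) ->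
  (forall i j x, O x -> is_derive x (delta_mx 0 j) (f1 i) (f2 i j x)) ->
  (forall x, O x -> \sum_i f2 i i x = 0) ->
  har_open O f.
Proof.
move=> oO cf c1 c2 d1 d2 f0.
have [Cf Lf] := Ck_on_2I oO cf c1 c2 d1 d2.
by split=> // x Ox; rewrite Lf// f0.
Qed.

Context (hd : (0 < d)%N).

Lemma is_derive_ev_shift z x v e : x != z ->
  is_derive x v (fun y => ev (y - z) e) (ev (x - z) (D v e)).
Proof.
rewrite -subr_eq0 => xz; apply/is_derive_lineP.
under eq_fun do rewrite -addrA.
by apply/(is_derive_lineP (ev^~ e)); exact: is_derive_ev.
Qed.

Lemma continuous_ev_shift z x e : x != z ->
  {for x, continuous (fun y => ev (y - z) e)}.
Proof.
rewrite -subr_eq0 => xz.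
apply: (@continuous_comp _ _ _ (fun y => y - z) (ev^~ e)).
  by apply: continuousB; [exact: cvg_id | exact: cst_continuous].
exact: continuous_ev.
Qed.

Lemma har_ev O z n v : open O -> ~ O z ->
  har_open O (fun x => ev (x - z) (iter n (D v) Efund)).
Proof.
move=> oO Oz; set e := iter n (D v) Efund.
have Oneq x : O x -> x != z by move=> Ox; apply: contra_notN Oz => /eqP <-.
apply: (@har_openI _ _ (fun i x => ev (x - z) (D (delta_mx 0 i) e))
  (fun i j x => ev (x - z) (D (delta_mx 0 j) (D (delta_mx 0 i) e)))) => //.
- by move=> x /Oneq; exact: continuous_ev_shift.
- by move=> i x /Oneq; exact: continuous_ev_shift.
- by move=> i j x /Oneq; exact: continuous_ev_shift.
- by move=> i x /Oneq; exact: is_derive_ev_shift.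
- by move=> i j x /Oneq; exact: is_derive_ev_shift.
- move=> x /Oneq; rewrite -subr_eq0 => xz.
  by have := lapE_iterD_Fund hd n v xz; rewrite ev_sumE.
Qed.

(** * Harmonic Taylor polynomials of the fundamental solution *)

Section taylor_polynomial.
Context (w : V) (w0 : w != 0).

(* [n!] times the [n]-th term, a homogeneous polynomial in [x], of the Taylor
   expansion of [e] at [w]. *)
Definition taylor n (e : expr) x : R := ev w (iter n (D x) e).

Lemma taylor_eqv n e1 e2 x : eqv e1 e2 -> taylor n e1 x = taylor n e2 x.
Proof. by move=> e12; exact: (eqv_iterD hd). Qed.

(** [x] enters [taylor] only as a direction of differentiation at the fixed point [w]; expanding one
    differentiation by [D_linear] makes the dependence on [x] visibly polynomial. *)
Lemma taylorS n e x :
  taylor n.+1 e x = \sum_i x 0 i * taylor n (D (delta_mx 0 i) e) x.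
Proof.
rewrite /taylor iterSr.
rewrite (@eqv_iterD _ _ hd n x _ (sumE (fun i => Emul (Ecst (x 0 i)) (D (delta_mx 0 i) e))))//.
  rewrite iterD_sumE ev_sumE; apply: eq_bigr => i _.
  exact: (iterD_mulC hd).
by move=> y y0; rewrite D_linear ev_sumE.
Qed.

Lemma continuous_taylor n e : continuous (taylor n e).
Proof.
elim: n e => [|n IHn] e x; first exact: cst_continuous.
have -> : taylor n.+1 e = fun x => \sum_i x 0 i * taylor n (D (delta_mx 0 i) e) x.
  by apply/funext => y; exact: taylorS.
apply: continuous_sum_at => i; apply: continuousM; last exact: IHn.
exact: coord_continuous.
Qed.

(** Product rule for the [n]-th power of the operator [D x]: its factors commute by [DC], and
    differentiating one of them replaces [x] by [u]. At [n = 0] the factor [n] makes the truncated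
    [n.-1] harmless. *)
Lemma is_derive_taylor n e x u :
  is_derive x u (taylor n e) (n%:R * taylor n.-1 (D u e) x).
Proof.
elim: n e => [|n IHn] e; first by rewrite mul0r; exact: is_derive_cst.
have -> : taylor n.+1 e = fun x => \sum_i x 0 i * taylor n (D (delta_mx 0 i) e) x.
  by apply/funext => y; exact: taylorS.
apply: (@is_derive_eq _ _ _ _ _ _ _ _ (is_derive_bigsum _
  (fun i => is_derive_mul (is_derive_coord x u i) (IHn (D (delta_mx 0 i) e))))).
rewrite big_split /=.
have -> : \sum_i u 0 i * taylor n (D (delta_mx 0 i) e) x = taylor n (D u e) x.
  rewrite /taylor [RHS](@eqv_iterD _ _ hd n x _
    (sumE (fun i => Emul (Ecst (u 0 i)) (D (delta_mx 0 i) e))))//.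
    rewrite iterD_sumE ev_sumE; apply: eq_bigr => i _.
    by rewrite iterD_mulC.
  by move=> y y0; rewrite D_linear ev_sumE.
rewrite -[n.+1]add1n natrD mulrDl mul1r; congr (_ + _).
case: n {IHn} => [|n] /=; first by rewrite mul0r big1// => i _; rewrite !mul0r mulr0.
rewrite taylorS mulr_sumr; apply: eq_bigr => i _.
rewrite mulrCA; congr (_ * (_ * _)).
by apply: taylor_eqv => y y0; rewrite DC.
Qed.

(** The Laplacian in [x] of the [n]-th term is [n (n-1)] times the [(n-2)]-th term of the Laplacian
    of [Efund], which is zero. *)
Lemma har_taylor O n : open O -> har_open O (taylor n Efund).
Proof.
move=> oO.
apply: (@har_openI _ _
  (fun i x => n%:R * taylor n.-1 (D (delta_mx 0 i) Efund) x)
  (fun i j x => n%:R * (n.-1%:R *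
    taylor n.-2 (D (delta_mx 0 j) (D (delta_mx 0 i) Efund)) x))) => //.
- by move=> x _; exact: continuous_taylor.
- move=> i x _; apply: continuousM; first exact: cst_continuous.
  exact: continuous_taylor.
- move=> i j x _; apply: continuousM; first exact: cst_continuous.
  apply: continuousM; first exact: cst_continuous.
  exact: continuous_taylor.
- by move=> i x _; exact: is_derive_taylor.
- move=> i j x _; apply: is_deriveZ; exact: is_derive_taylor.
- move=> x _; rewrite -!mulr_sumr.
  have := taylor_eqv n.-2 x (@lapE_Fund R d).
  rewrite /taylor iterD_sumE ev_sumE iterD_cst0 => ->.
  by rewrite !mulr0.
Qed.

End taylor_polynomial.

End harmonic_tests.

(** * Taylor expansion of the fundamental solution *)

Section taylor_remainder.
Context {R : realType}.

Lemma derive_ge0_le (h dh : R -> R) (a : R) :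
  (forall t, 0 <= t <= a -> is_derive t 1 h (dh t)) ->
  (forall t, 0 <= t <= a -> 0 <= dh t) ->
  forall t, 0 <= t <= a -> h 0 <= h t.
Proof.
move=> dE d0 t /andP[t0 ta].
have sub c : c \in `[0, t] -> 0 <= c <= a.
  by rewrite in_itv/= => /andP[-> ct]; exact: le_trans ct ta.
have sub' c : c \in `]0, t[ -> 0 <= c <= a.
  by move=> c0t; apply/sub/(subset_itv_oo_cc c0t).
have [||c ct E] := @MVT_segment R h dh 0 t t0.
- by move=> c /sub'; exact: dE.
- apply: continuous_in_subspaceT => c; rewrite inE/= => /sub/dE[dh' _].
  exact/differentiable_continuous/derivable1_diffP.
- rewrite -subr_ge0 E subr0 mulr_ge0// d0//; exact: sub.
Qed.

Definition powfact k (t : R) : R := k`!%:R^-1 * t ^+ k.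

Lemma is_derive_powfactS k (t : R) :
  is_derive t 1 (powfact k.+1) (powfact k t).
Proof.
have -> : powfact k.+1 = k.+1`!%:R^-1 *: (id ^+ k.+1) :> (R -> R).
  by apply/funext => s; rewrite /powfact !fctE.
apply: is_derive_eq.
rewrite /GRing.scale/= mulr1 /powfact factS natrM; field.
by rewrite nat1r !pnatr_eq0 -lt0n fact_gt0.
Qed.

(** Induction on the shifted family bounds the derivative of [f 0 - P]; adding to or subtracting
    from [M t^n / n!] gives nondecreasing functions, so no intermediate point or integral remainder
    is needed. *)
Lemma taylor_remainder n (f : nat -> R -> R) (a M : R) :
  (forall k (t : R), (k < n)%N -> 0 <= t <= a -> is_derive t 1 (f k) (f k.+1 t)) ->
  (forall t : R, 0 <= t <= a -> `|f n t| <= M) ->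
  forall t : R, 0 <= t <= a ->
  `|f 0%N t - \sum_(k < n) f k 0 * powfact k t| <= M * powfact n t.
Proof.
elim: n f => [|n IHn] f df fM t ta.
  by rewrite big_ord0 subr0 /powfact fact0 expr0 invr1 !mulr1 fM.
have IH := IHn (fun k => f k.+1) (fun k s kn => df k.+1 s kn) fM.
pose P s := \sum_(k < n.+1) f k 0 * powfact k s.
have PE s : P s = f 0%N 0 + \sum_(k < n) f k.+1 0 * powfact k.+1 s.
  by rewrite /P big_ord_recl/= /powfact fact0 expr0 invr1 !mulr1.
have dP (s : R) : is_derive s 1 P (\sum_(k < n) f k.+1 0 * powfact k s).
  have -> : P = fun s => f 0%N 0 + \sum_(k < n) f k.+1 0 * powfact k.+1 s.
    exact/funext.
  rewrite -[X in is_derive _ _ _ X]add0r; apply: is_derive_add.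
  apply: is_derive_bigsum => k; apply: is_deriveZ; exact: is_derive_powfactS.
have P0 : P 0 = f 0%N 0.
  rewrite PE big1 ?addr0// => k _; rewrite /powfact expr0n/= !mulr0//.
have pf0 : powfact n.+1 0 = 0 :> R by rewrite /powfact expr0n/= mulr0.
have dfP (s : R) : 0 <= s <= a -> is_derive s 1 (fun s => f 0%N s - P s)
    (f 1%N s - \sum_(k < n) f k.+1 0 * powfact k s).
  by move=> sa; apply: is_deriveB; exact: df.
rewrite -[X in `|_ - X|]/(P t) ler_norml; apply/andP; split.
- have := @derive_ge0_le (fun s => (f 0%N s - P s) + M * powfact n.+1 s)
    (fun s => (f 1%N s - \sum_(k < n) f k.+1 0 * powfact k s) + M * powfact n s) a.
  move=> /(_ _ _ t ta); rewrite P0 pf0 mulr0 addr0 subrr => h.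
  rewrite -subr_ge0 opprK; apply: h => s sa.
    apply: is_derive_add; first exact: dfP.
    apply: is_deriveZ; exact: is_derive_powfactS.
  by have := IH s sa; rewrite ler_norml => /andP[+ _]; rewrite -subr_ge0 opprK.
- have := @derive_ge0_le (fun s => M * powfact n.+1 s - (f 0%N s - P s))
    (fun s => M * powfact n s - (f 1%N s - \sum_(k < n) f k.+1 0 * powfact k s)) a.
  move=> /(_ _ _ t ta); rewrite P0 pf0 mulr0 subrr subr0 => h.
  rewrite -subr_ge0; apply: h => s sa.
    apply: is_deriveB; last exact: dfP.
    apply: is_deriveZ; exact: is_derive_powfactS.
  by have := IH s sa; rewrite ler_norml => /andP[_]; rewrite -subr_ge0.
Qed.

End taylor_remainder.

(** * Factorial bounds for directional derivatives of the fundamental solution *)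

Section derivative_bounds.
Context {R : realType} {d : nat} (hd : (0 < d)%N).
Local Notation V := 'rV[R]_d.
Implicit Types (u v w x y z : V).

(* [n]-fold derivative of [dot w w * D_v T = - d * dot w v * T], where
   [T w = |w|^(-d)]; it gives the factorial bounds needed for analyticity. *)
Lemma iterD_Epow_rec n w v : w != 0 ->
  dot w w * ev w (iter n.+1 (D v) (Epow d)) =
  - ((2 * n + d)%:R * dot w v * ev w (iter n (D v) (Epow d))
     + (n * (n.-1 + d))%:R * dot v v * ev w (iter n.-1 (D v) (Epow d))).
Proof.
elim: n w => [|n IHn] w w0.
  rewrite muln0 add0n mul0n !mul0r addr0 /= -sqr_rho !exprS; field.
  by rewrite gt_eqF ?rho_gt0.
have d1 : is_derive w v (fun w => dot w w * ev w (iter n.+1 (D v) (Epow d)))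
    (2 * dot w v * ev w (iter n.+1 (D v) (Epow d))
     + dot w w * ev w (iter n.+2 (D v) (Epow d))).
  by apply: is_derive_mul; [exact: is_derive_sqnorm | exact: is_derive_ev].
have d2 : is_derive w v (fun w =>
    - ((2 * n + d)%:R * dot w v * ev w (iter n (D v) (Epow d))
     + (n * (n.-1 + d))%:R * dot v v * ev w (iter n.-1 (D v) (Epow d))))
    (- ((2 * n + d)%:R * dot v v * ev w (iter n (D v) (Epow d))
        + (2 * n + d)%:R * dot w v * ev w (iter n.+1 (D v) (Epow d))
     + (n * (n.-1 + d))%:R * dot v v * ev w (iter n (D v) (Epow d)))).
  apply: is_deriveN; apply: is_derive_add.
    apply: is_derive_mul; last exact: is_derive_ev.
    apply: is_deriveZ; exact: is_derive_dot.
  case: (n) => [|m]; first by rewrite !mul0n !mul0r; under eq_fun do rewrite !mul0r; exact: is_derive_cst.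
  apply: is_deriveZ; exact: is_derive_ev.
have E : \forall y \near w, _ := filterS (fun y => IHn y) (near_neq0 w0).
have {}E := is_derive_near_unique (E _) d1 d2.
have -> : dot w w * ev w (iter n.+2 (D v) (Epow d)) =
  - ((2 * n + d)%:R * dot v v * ev w (iter n (D v) (Epow d))
      + (2 * n + d)%:R * dot w v * ev w (iter n.+1 (D v) (Epow d))
   + (n * (n.-1 + d))%:R * dot v v * ev w (iter n (D v) (Epow d)))
  - 2 * dot w v * ev w (iter n.+1 (D v) (Epow d)).
  by rewrite -E; ring.
by case: (n) => [|m]; rewrite ?(natrD, natrM, mulrSr); ring.
Qed.

(** Leibniz formula, which stops after two terms because the factor [Elin v] is linear. *)
Lemma iterD_LinMul n w v e : w != 0 ->
  ev w (iter n (D v) (Emul (Elin v) e)) =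
  dot w v * ev w (iter n (D v) e) + n%:R * dot v v * ev w (iter n.-1 (D v) e).
Proof.
elim: n e => [|n IHn] e w0; first by rewrite !mul0r addr0.
rewrite iterSr /= iterD_add /= IHn// iterD_mulC//= -iterSr.
case: n {IHn} => [|n]; first by rewrite /= !mul0r; ring.
by rewrite /= -iterS -iterSr mulrS; ring.
Qed.

(* Each further derivative along [v] of the fundamental solution at [w] costs at
   most a factor [n * deriv_ratio * |v| / |w|]. *)
Definition deriv_ratio : R := (d * (d + 3))%:R.

(** Abstract form of [iterD_Epow_rec] after division by [dot w w]: [a n] stands for the absolute
    value of the [n]-th derivative of [|w|^(-d)] and [q] for [|v| / |w|]. *)
Lemma rec_bound (a : nat -> R) (q : R) : 0 <= q -> (forall n, 0 <= a n) ->
  (forall n, a n.+1 <= (2 * n + d)%:R * d%:R * q * a n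
                       + (n * (n.-1 + d))%:R * d%:R * q ^+ 2 * a n.-1) ->
  forall n, a n <= a 0%N * n`!%:R * (deriv_ratio * q) ^+ n.
Proof.
move=> q0 a0 ar.
have step n : (forall m, (m <= n)%N -> a m <= a 0%N * m`!%:R * (deriv_ratio * q) ^+ m) ->
    a n.+1 <= a 0%N * (n.+1)`!%:R * (deriv_ratio * q) ^+ n.+1.
  move=> IH; apply: (le_trans (ar n)).
  have d1 : 1 <= d%:R :> R by rewrite ler1n.
  case: n IH => [|n] IH.
    rewrite muln0 mul0n !mul0r addr0 add0n (_ : 1`! = 1)%N// expr1 mulr1 /deriv_ratio.
    rewrite natrM natrD; have := mulr_ge0 (a0 0%N) q0; nra.
  have IH1 := IH n.+1 (leqnn _); have IH0 := IH n (leqnSn _).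
  apply: (@le_trans _ _ ((2 * n.+1 + d)%:R * d%:R * q * (a 0%N * (n.+1)`!%:R * (deriv_ratio * q) ^+ n.+1)
     + (n.+1 * (n + d))%:R * d%:R * q ^+ 2 * (a 0%N * n`!%:R * (deriv_ratio * q) ^+ n))).
    by apply: lerD; apply: ler_wpM2l => //; rewrite !mulr_ge0// exprn_ge0.
  rewrite !factS !(exprS (deriv_ratio * q)).
  set F := n`!%:R; set X := (deriv_ratio * q) ^+ n.
  have F0 : 0 <= F by rewrite ler0n.
  have X0 : 0 <= X by rewrite exprn_ge0// mulr_ge0// ler0n.
  have -> : (2 * n.+1 + d)%:R * d%:R * q * (a 0%N * (n.+1 * n`!)%:R * (deriv_ratio * q * X))
     + (n.+1 * (n + d))%:R * d%:R * q ^+ 2 * (a 0%N * n`!%:R * X)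
     = (n.+1%:R * a 0%N * F * X * q ^+ 2) * ((2 * n.+1 + d)%:R * d%:R * deriv_ratio + (n + d)%:R * d%:R).
    by rewrite !natrM -/F; ring.
  have -> : a 0%N * (n.+2 * (n.+1 * n`!))%:R * (deriv_ratio * q * (deriv_ratio * q * X))
    = (n.+1%:R * a 0%N * F * X * q ^+ 2) * (n.+2%:R * deriv_ratio ^+ 2).
    by rewrite !natrM -/F; ring.
  apply: ler_wpM2l; first by rewrite !mulr_ge0 ?ler0n// exprn_ge0.
  (* Writing [T] for [deriv_ratio], what remains is [(2(n+1)+d) d T + (n+d) d <= (n+2) T^2]; the
     value [T = d (d+3)] is large enough for all [n] and all [d >= 1]. The products below are hints
     for [nra]. *)
  rewrite /deriv_ratio !(natrM, natrD) -![n.+2%:R]natr1 -![n.+1%:R]natr1.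
  have n0 : 0 <= n%:R :> R by rewrite ler0n.
  move: d1 n0; set x := d%:R; set y := n%:R => x1 y0.
  have x0 : 0 <= x by lra.
  have := mulr_ge0 (mulr_ge0 x0 x0) y0.
  have := mulr_ge0 (mulr_ge0 (mulr_ge0 x0 x0) y0) x0.
  have := mulr_ge0 (mulr_ge0 x0 x0) (mulr_ge0 x0 x0).
  have := mulr_ge0 (mulr_ge0 x0 x0) x0.
  have := mulr_ge0 (mulr_ge0 (mulr_ge0 x0 x0) (mulr_ge0 x0 x0)) y0.
  have := mulr_ge0 (mulr_ge0 x0 x0) (_ : 0 <= x - 1).
  have := mulr_ge0 y0 (_ : 0 <= x * (x - 1)).
  nra.
elim/ltn_ind => -[_|n IH]; first by rewrite fact0 expr0 !mulr1.
by apply: step => m mn; apply: IH.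
Qed.

Lemma iterD_Epow_bound n w v : w != 0 ->
  `|ev w (iter n (D v) (Epow d))| <=
  `|w|^-1 ^+ d * n`!%:R * (deriv_ratio * (`|v| / `|w|)) ^+ n.
Proof.
move=> w0; set q := `|v| / `|w|.
have nw0 : 0 < `|w| by rewrite normr_gt0.
have q0 : 0 <= q by rewrite divr_ge0.
have s0 := dot_gt0 w0.
pose a n := `|ev w (iter n (D v) (Epow d))|.
have a0 m : 0 <= a m by rewrite /a.
have vE : `|v| = q * `|w| by rewrite /q divfK// gt_eqF.
have bE : `|dot w v| <= d%:R * q * dot w w.
  apply: (le_trans (dot_le_norm w v)); rewrite vE -[leRHS]mulrA ler_wpM2l//.
  by rewrite mulrCA ler_wpM2l// -expr2 norm_le_dot.
have cE : `|dot v v| <= d%:R * q ^+ 2 * dot w w.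
  apply: (le_trans (dot_le_norm v v)); rewrite vE -[leRHS]mulrA ler_wpM2l//.
  rewrite mulrACA -!expr2 ler_wpM2l ?exprn_ge0//; exact: norm_le_dot.
have ar m : a m.+1 <= (2 * m + d)%:R * d%:R * q * a m
                       + (m * (m.-1 + d))%:R * d%:R * q ^+ 2 * a m.-1.
  rewrite -(ler_pM2l s0).
  have -> : dot w w * a m.+1 = `|dot w w * ev w (iter m.+1 (D v) (Epow d))|.
    by rewrite normrM gtr0_norm.
  rewrite iterD_Epow_rec// normrN mulrDr (le_trans (ler_normD _ _))//.
  rewrite !normrM !normr_nat.
  apply: lerD; rewrite mulrA; apply: ler_wpM2r => //.
    rewrite [leRHS](_ : _ = (2 * m + d)%:R * (d%:R * q * dot w w)).
      exact: ler_wpM2l.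
    by move: (q) => x; ring.
  rewrite [leRHS](_ : _ = (m * (m.-1 + d))%:R * (d%:R * q ^+ 2 * dot w w)).
    exact: ler_wpM2l.
  by move: (q) => x; ring.
have := rec_bound q0 a0 ar n; rewrite /a => /le_trans; apply.
apply: ler_wpM2r; first by rewrite exprn_ge0// mulr_ge0// ler0n.
rewrite ler_wpM2r//= ger0_norm ?exprn_ge0 ?invr_ge0 ?sqrtr_ge0//.
rewrite lerXn2r ?nnegrE ?invr_ge0 ?sqrtr_ge0//.
rewrite lef_pV2 ?posrE ?rho_gt0//.
by rewrite -(ler_pXn2r (ltn0Sn 1)) ?nnegrE ?sqrtr_ge0// sqr_rho norm_le_dot.
Qed.

Lemma deriv_ratio_ge4 : 4 <= deriv_ratio :> R.
Proof.
by rewrite /deriv_ratio ler_nat (@leq_trans (1 * (1 + 3))%N)// leq_mul// leq_add2r.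
Qed.

(** One derivative turns [Efund] into [dot w v * |w|^(-d)], to which [iterD_LinMul] applies; each of
    its two terms accounts for one half of the factor 2. Order zero is excluded, since for [d = 2]
    the kernel itself is a logarithm. *)
Lemma iterD_Efund_bound n w v : (0 < n)%N -> w != 0 ->
  `|ev w (iter n (D v) Efund)| <=
  2 * d%:R * `|w| ^+ 2 * `|w|^-1 ^+ d * n`!%:R * (deriv_ratio * (`|v| / `|w|)) ^+ n.
Proof.
case: n => // n _ w0; rewrite iterSr.
have -> : D v Efund = Emul (Elin v) (Epow d) by [].
rewrite iterD_LinMul//; set q := `|v| / `|w|.
have nw0 : 0 < `|w| by rewrite normr_gt0.
have q0 : 0 <= q by rewrite divr_ge0.
have vE : `|v| = q * `|w| by rewrite /q divfK// gt_eqF.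
have th4 := deriv_ratio_ge4.
have tq : q <= deriv_ratio * q by rewrite ler_peMl//; lra.
have tq0 : 0 <= deriv_ratio * q by exact: le_trans tq.
set A := `|w|^-1 ^+ d; have A0 : 0 <= A by rewrite exprn_ge0// invr_ge0.
apply: (le_trans (ler_normD _ _)); rewrite !normrM normr_nat.
have -> : 2 * d%:R * `|w| ^+ 2 * A * (n.+1)`!%:R * (deriv_ratio * q) ^+ n.+1 =
  d%:R * `|w| ^+ 2 * A * (n.+1)`!%:R * (deriv_ratio * q) ^+ n.+1 +
  d%:R * `|w| ^+ 2 * A * (n.+1)`!%:R * (deriv_ratio * q) ^+ n.+1 by ring.
have fn : n`!%:R <= (n.+1)`!%:R :> R by rewrite ler_nat factS leq_pmull.
apply: lerD.
  apply: (@le_trans _ _ (d%:R * (`|w| * `|v|) * (A * n`!%:R * (deriv_ratio * q) ^+ n))).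
    by apply: ler_pM => //; [exact: dot_le_norm | exact: iterD_Epow_bound].
  have -> : d%:R * (`|w| * `|v|) * (A * n`!%:R * (deriv_ratio * q) ^+ n) =
    (d%:R * `|w| ^+ 2 * A) * (n`!%:R * (q * (deriv_ratio * q) ^+ n)) by rewrite vE; ring.
  rewrite -[leRHS]mulrA ler_wpM2l ?mulr_ge0 ?exprn_ge0//.
  by apply: ler_pM; rewrite ?mulr_ge0 ?exprn_ge0// exprS ler_wpM2r ?exprn_ge0.
case: n {fn} => [|n].
  by rewrite !mul0r; do ?[by [] | apply: mulr_ge0 | apply: exprn_ge0].
apply: (@le_trans _ _ (n.+1%:R * (d%:R * (`|v| * `|v|)) * (A * n`!%:R * (deriv_ratio * q) ^+ n))).
  apply: ler_pM => //.
    by apply: ler_wpM2l => //; exact: dot_le_norm.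
  exact: iterD_Epow_bound.
have -> : n.+1%:R * (d%:R * (`|v| * `|v|)) * (A * n`!%:R * (deriv_ratio * q) ^+ n) =
  (d%:R * `|w| ^+ 2 * A) * ((n.+1)`!%:R * (q * (q * (deriv_ratio * q) ^+ n))).
  by rewrite vE factS natrM; ring.
rewrite -[leRHS]mulrA ler_wpM2l ?mulr_ge0 ?exprn_ge0//.
rewrite ler_pM ?mulr_ge0 ?exprn_ge0//.
  by rewrite ler_nat [leqRHS]factS leq_pmull.
rewrite !exprS; apply: ler_pM; rewrite ?mulr_ge0 ?exprn_ge0//.
by apply: ler_pM; rewrite ?mulr_ge0 ?exprn_ge0.
Qed.

Lemma is_derive_ev_line w v (t : R) e : t *: v + w != 0 ->
  is_derive t (1 : R) (fun s => ev (s *: v + w) e) (ev (t *: v + w) (D v e)).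
Proof.
move=> tw0; apply/is_derive_lineP.
under eq_fun do rewrite [_%:A]mulr1 scalerDl -addrA.
by apply/(is_derive_lineP (ev^~ e)); exact: is_derive_ev.
Qed.

(** The coefficient [2 d |w|^2 |w|^(-d)] of [iterD_Efund_bound], majorized on the shell
    [N/2 <= |w| <= 2N]. *)
Definition taylor_cst (N : R) : R := 8 * d%:R * N ^+ 2 * (2 / N) ^+ d.

(** The factorial of the [n]-th derivative cancels that of the Taylor remainder, leaving a geometric
    term. The smallness of [v] makes its ratio at most [1/2] and keeps the segment from [w] to
    [v + w] in the shell of [taylor_cst], away from the pole. *)
Lemma taylor_Efund n w v : (0 < n)%N -> w != 0 -> 4 * deriv_ratio * `|v| <= `|w| ->
  `|ev (v + w) Efund - \sum_(k < n) k`!%:R^-1 * ev w (iter k (D v) Efund)| <=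
  taylor_cst `|w| * (2 * deriv_ratio * (`|v| / `|w|)) ^+ n.
Proof.
move=> n0 w0 vw; have nw0 : 0 < `|w| by rewrite normr_gt0.
have th4 := deriv_ratio_ge4.
have v16 : 16 * `|v| <= `|w|.
  by apply: le_trans vw; rewrite ler_wpM2r//; lra.
have seg (t : R) : 0 <= t <= 1 -> `|w| / 2 <= `|t *: v + w| <= 2 * `|w|.
  move=> /andP[t0 t1].
  have tv : `|t *: v| <= `|v| by rewrite normrZ ger0_norm// ler_piMl.
  have := ler_normD (t *: v) w; have := lerB_normD w (t *: v).
  rewrite [w + _]addrC; have := normr_ge0 v; lra.
have seg0 (t : R) : 0 <= t <= 1 -> t *: v + w != 0.
  by move=> /seg/andP[+ _]; rewrite -normr_gt0; apply: lt_le_trans; lra.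
have C0 : 0 <= taylor_cst `|w|.
  by rewrite /taylor_cst !mulr_ge0 ?exprn_ge0 ?divr_ge0.
have df (k : nat) (t : R) : (k < n)%N -> 0 <= t <= 1 ->
    is_derive t 1 (fun t : R => ev (t *: v + w) (iter k (D v) Efund))
      (ev (t *: v + w) (iter k.+1 (D v) Efund)).
  by move=> _ t01; apply: is_derive_ev_line; exact: seg0.
have fM (t : R) : 0 <= t <= 1 -> `|ev (t *: v + w) (iter n (D v) Efund)| <=
    taylor_cst `|w| * (2 * deriv_ratio * (`|v| / `|w|)) ^+ n * n`!%:R.
  move=> t01.
  have /andP[wl wu] := seg _ t01.
  apply: (le_trans (iterD_Efund_bound v n0 (seg0 _ t01))).
  have nt0 : 0 < `|t *: v + w| by rewrite normr_gt0 seg0.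
  have iv : `|t *: v + w|^-1 <= 2 / `|w|.
    by rewrite -[2 / _]invf_div lef_pV2 ?posrE ?divr_gt0.
  have th0 : 0 <= deriv_ratio :> R by rewrite ler0n.
  rewrite mulrAC ler_wpM2r ?ler0n//.
  apply: ler_pM; rewrite ?mulr_ge0 ?exprn_ge0 ?mulr_ge0 ?divr_ge0//.
    rewrite /taylor_cst; apply: ler_pM; rewrite ?mulr_ge0 ?exprn_ge0 ?divr_ge0//.
      have : `|t *: v + w| ^+ 2 <= (2 * `|w|) ^+ 2.
        by rewrite lerXn2r ?nnegrE ?mulr_ge0.
      have : 0 <= d%:R :> R by [].
      nra.
    by rewrite lerXn2r ?nnegrE ?divr_ge0 ?invr_ge0.
  rewrite lerXn2r ?nnegrE ?mulr_ge0 ?divr_ge0//.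
  have -> : 2 * deriv_ratio * (`|v| / `|w|) = deriv_ratio * (`|v| * (2 / `|w|)) by ring.
  by apply: ler_wpM2l => //; apply: ler_wpM2l.
have := @taylor_remainder R n
  (fun k t => ev (t *: v + w) (iter k (D v) Efund)) 1 _ df fM 1.
rewrite lexx ler01 scale1r scale0r add0r => /(_ isT).
rewrite /powfact expr1n mulr1 mulfK; last by rewrite pnatr_eq0 -lt0n fact_gt0.
apply: le_trans; rewrite le_eqVlt; apply/orP; left; apply/eqP.
congr (`|_ - _|); apply: eq_bigr => k _.
by rewrite expr1n mulr1 mulrC.
Qed.

End derivative_bounds.

(** * The potential of an annihilating functional *)

Section annihilating_functional.
Context {R : realType} {d : nat} (hd : (0 < d)%N).
Local Notation V := 'rV[R]_d.
Local Notation deriv_ratio := (@deriv_ratio R d).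
Implicit Types (O K : set V) (f g : V -> R) (u v w x y z : V).

Definition continuous_at_pts K f := forall x, K x -> {for x, continuous f}.

(** All that is retained of [mu - theta]. The first two clauses are restricted to functions
    continuous at the points of [K] because [I] accepts arbitrary functions, on which an integral
    need not be linear or bounded. *)
Record annihilates O K (I : (V -> R) -> R) : Prop := Annihilates {
  annih_lin : forall a f g, continuous_at_pts K f -> continuous_at_pts K g ->
    I (fun x => a * f x + g x) = a * I f + I g;
  annih_bound : exists2 C, 0 <= C & forall f M, continuous_at_pts K f ->
    0 <= M -> (forall x, K x -> `|f x| <= M) -> `|I f| <= C * M;
  annih_har : forall f, har_open O f -> I f = 0 }.

Context (O K : set V) (I : (V -> R) -> R).
Context (openO : open O) (cK : compact K) (KO : K `<=` O) (AI : annihilates O K I).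

Lemma continuous_pts_sub f g : continuous_at_pts K f ->
  continuous_at_pts K g -> continuous_at_pts K (fun x => f x - g x).
Proof. by move=> cf cg x Kx; apply: (@continuousB R R^o); auto. Qed.

Lemma continuous_pts_sum (T : Type) (s : seq T) (F : T -> V -> R) :
  (forall i, continuous_at_pts K (F i)) ->
  continuous_at_pts K (fun x => \sum_(i <- s) F i x).
Proof. by move=> cF x Kx; apply: continuous_sum_at => i; exact: cF. Qed.

Lemma continuous_pts_cst (a : R) : continuous_at_pts K (fun=> a).
Proof. by move=> x _; exact: cst_continuous. Qed.

Lemma annih0 : I (fun=> 0) = 0.
Proof.
have [C C0 Cb] := annih_bound AI.
apply/eqP; rewrite -normr_le0 -[leRHS](mulr0 C); apply: Cb => //.
  exact: continuous_pts_cst.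
by move=> x _; rewrite normr0.
Qed.

Lemma annihZ a f : continuous_at_pts K f -> I (fun x => a * f x) = a * I f.
Proof.
move=> cf; have := annih_lin AI a cf (@continuous_pts_cst 0).
by under eq_fun do rewrite addr0; rewrite annih0 addr0.
Qed.

Lemma annihD f g : continuous_at_pts K f -> continuous_at_pts K g ->
  I (fun x => f x + g x) = I f + I g.
Proof.
move=> cf cg; have := annih_lin AI 1 cf cg.
by under eq_fun do rewrite mul1r; rewrite mul1r.
Qed.

Lemma annihB f g : continuous_at_pts K f -> continuous_at_pts K g ->
  I (fun x => f x - g x) = I f - I g.
Proof.
move=> cf cg; have := annih_lin AI (-1) cg cf.
by rewrite mulN1r addrC => <-; congr I; apply/funext => x; rewrite mulN1r addrC.
Qed.

Lemma annih_sum (T : Type) (s : seq T) (F : T -> V -> R) :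
  (forall i, continuous_at_pts K (F i)) ->
  I (fun x => \sum_(i <- s) F i x) = \sum_(i <- s) I (F i).
Proof.
move=> cF; elim: s => [|i s IHs].
  by rewrite big_nil -[RHS]annih0; congr I; apply/funext => x; rewrite big_nil.
rewrite big_cons -IHs -annihD//; last exact: continuous_pts_sum.
by congr I; apply/funext => x; rewrite big_cons.
Qed.

Lemma eq_annih f g : continuous_at_pts K f -> continuous_at_pts K g ->
  (forall x, K x -> f x = g x) -> I f = I g.
Proof.
move=> cf cg fg; apply/eqP; rewrite -subr_eq0 -annihB//; apply/eqP.
have [C C0 Cb] := annih_bound AI.
apply/eqP; rewrite -normr_le0 -[leRHS](mulr0 C); apply: Cb => //.
  exact: continuous_pts_sub.
by move=> x Kx; rewrite fg// subrr normr0.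
Qed.

(** Used off [K] only, where the kernel is continuous at every point of [K]. *)
Definition potential y : R := I (fun x => ev (x - y) Efund).

Definition potential_coef z k v : R :=
  I (fun x => ev (x - z) (iter k (D v) Efund)).

Lemma cont_ev_pts z e : ~ K z -> continuous_at_pts K (fun x => ev (x - z) e).
Proof.
move=> Kz x Kx; apply: continuous_ev_shift => //.
by apply: contra_notN Kz => /eqP <-.
Qed.

Lemma iterD_scale k w (t : R) v e : w != 0 ->
  ev w (iter k (D (t *: v)) e) = t ^+ k * ev w (iter k (D v) e).
Proof.
move=> w0; elim: k e => [|k IHk] e; first by rewrite expr0 mul1r.
rewrite !iterSr.
rewrite (@eqv_iterD _ _ hd k (t *: v) _ (Emul (Ecst t) (D v e)))//; last first.
  move=> y y0 /=; rewrite D_linear [in RHS]D_linear mulr_sumr.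
  by apply: eq_bigr => i _; rewrite mxE mulrA.
by rewrite iterD_mulC//= IHk exprS; ring.
Qed.

Lemma compact_norm_bound : exists2 N : R, 0 < N & forall x, K x -> `|x| <= N.
Proof.
have /compact_bounded[M [_ KM]] := cK.
exists (`|M| + 1) => [|x Kx]; first by rewrite ltr_pwDr.
by apply: (KM (`|M| + 1)) => //; rewrite (le_lt_trans (ler_norm M))// ltrDl.
Qed.

Lemma dist_compact_gt0 z : ~ K z ->
  exists2 r : R, 0 < r & forall x, K x -> r <= `|x - z|.
Proof.
move=> Kz.
have oK : open (~` K).
  by apply: closed_openC; apply: compact_closed => //; exact: norm_hausdorff.
have /nbhs_ballP[r /= r0 rK] : nbhs z (~` K) by exact: open_nbhs_nbhs.
exists r => // x Kx; rewrite leNgt; apply/negP => xz.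
by apply: (rK x) => //; rewrite -ball_normE /= distrC.
Qed.

(** The kernel expansion is uniform for [x] in [K], so the functional applies term by term. The
    point [z - t v] makes the kernel argument [(x - z) + t v]. The bound keeps [t]: [vanish_ball]
    takes [t = 1] and lets [n] grow, [potential_coef_near] fixes [n] and lets [t] tend to 0. *)
Lemma taylor_potential z v (r : R) : 0 < r -> (forall x, K x -> r <= `|x - z|) ->
  4 * deriv_ratio * `|v| <= r ->
  exists2 B, 0 <= B & forall n (t : R), (0 < n)%N -> 0 <= t <= 1 ->
    `|potential (z - t *: v)
      - \sum_(k < n) k`!%:R^-1 * (t ^+ k * potential_coef z k v)| <= B * (t / 2) ^+ n.
Proof.
move=> r0 Kr vr.
have th0 : 0 <= deriv_ratio :> R by rewrite ler0n.
have Kz : ~ K z by move=> /Kr; rewrite subrr normr0 leNgt r0.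
have [N N0 KN] := compact_norm_bound.
have [C C0 Cb] := annih_bound AI.
(* [T] majorizes [taylor_cst |x - z|] for all [x] in [K], through [r <= |x - z| <= N + |z|]. *)
pose T := 8 * d%:R * (N + `|z|) ^+ 2 * (2 / r) ^+ d.
have T0 : 0 <= T by rewrite /T !mulr_ge0 ?exprn_ge0 ?divr_ge0 ?addr_ge0// ltW.
exists (C * T) => [|n t n0 /andP[t0 t1]]; first exact: mulr_ge0.
pose u k x := ev (x - z) (iter k (D v) Efund).
have cu k : continuous_at_pts K (u k) by exact: cont_ev_pts.
have vx x : K x -> 4 * deriv_ratio * `|t *: v| <= `|x - z|.
  move=> /Kr; apply: le_trans; apply: le_trans vr.
  by rewrite normrZ ger0_norm// ler_wpM2l ?mulr_ge0// ler_piMl.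
have Kzt : ~ K (z - t *: v).
  move=> /[dup] /vx + /Kr.
  rewrite [z - _]addrC addrK normrN => h h2.
  have := deriv_ratio_ge4 hd (R := R); nra.
have -> : \sum_(k < n) k`!%:R^-1 * (t ^+ k * potential_coef z k v) =
    I (fun x => \sum_(k < n) k`!%:R^-1 * t ^+ k * u k x).
  rewrite annih_sum => [|k x Kx].
    by apply: eq_bigr => k _; rewrite mulrA annihZ.
  by apply: continuousM; [exact: cst_continuous | exact: cu].
have cS : continuous_at_pts K (fun x => \sum_(k < n) k`!%:R^-1 * t ^+ k * u k x).
  apply: continuous_pts_sum => k x Kx.
  by apply: continuousM; [exact: cst_continuous | exact: cu].
have cP : continuous_at_pts K (fun x => ev (x - (z - t *: v)) Efund).
  exact: cont_ev_pts.
rewrite -annihB// -mulrA; apply: Cb.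
- exact: continuous_pts_sub.
- by rewrite mulr_ge0 ?exprn_ge0 ?divr_ge0.
move=> x Kx; have xz0 : x - z != 0 by rewrite -normr_gt0 (lt_le_trans r0)// Kr.
have := taylor_Efund hd n0 xz0 (vx x Kx).
have -> : t *: v + (x - z) = x - (z - t *: v) by rewrite opprB addrCA.
have -> : \sum_(k < n) k`!%:R^-1 * ev (x - z) (iter k (D (t *: v)) Efund) =
    \sum_(k < n) k`!%:R^-1 * t ^+ k * u k x.
  by apply: eq_bigr => k _; rewrite iterD_scale// mulrA.
move=> /le_trans; apply.
have xr := Kr x Kx; have xzN : `|x - z| <= N + `|z|.
  by apply: (le_trans (ler_normB _ _)); rewrite lerD2r KN.
have xz_gt0 : 0 < `|x - z| by rewrite normr_gt0.
apply: ler_pM; rewrite ?exprn_ge0 ?mulr_ge0 ?divr_ge0//.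
- rewrite /T /taylor_cst; apply: ler_pM; rewrite ?mulr_ge0 ?exprn_ge0 ?divr_ge0//.
    by apply: ler_wpM2l; rewrite ?mulr_ge0// lerXn2r ?nnegrE// (le_trans _ xzN).
  rewrite lerXn2r ?nnegrE ?divr_ge0 ?(ltW r0)//.
  by rewrite ler_wpM2l// lef_pV2.
- rewrite lerXn2r ?nnegrE ?mulr_ge0 ?divr_ge0//.
  rewrite mulrA ler_pdivrMr// normrZ ger0_norm//.
  have : t * (4 * deriv_ratio * `|v|) <= t * `|x - z|.
    by apply: ler_wpM2l => //; exact: le_trans xr.
  lra.
Qed.

Lemma geometric_le0 (x B : R) : (forall n, (0 < n)%N -> `|x| <= B * (2^-1) ^+ n) -> x = 0.
Proof.
move=> h; apply/eqP/negPn/negP; rewrite -normr_gt0 => x0.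
have cv : (fun n => B * (2^-1) ^+ n) @ \oo --> (0 : R).
  rewrite -[X in _ --> X](mulr0 B); apply: cvgMr; apply: cvg_expr.
  by rewrite ger0_norm// invf_lt1// ltr1n.
near \oo => n.
have n0 : (0 < n)%N by near: n; exact: nbhs_infty_gt.
have : `|B * 2^-1 ^+ n| < `|x| by near: n; exact: cvgr0_norm_lt.
by rewrite ltNge (le_trans (h n n0))// ler_norm.
Unshelve. all: by end_near. Qed.

Lemma vanish_ball z y (r : R) : 0 < r -> (forall x, K x -> r <= `|x - z|) ->
  4 * deriv_ratio * `|y - z| <= r ->
  (forall k, potential_coef z k (z - y) = 0) -> potential y = 0.
Proof.
move=> r0 Kr yr c0.
have [|B B0 TB] := @taylor_potential z (z - y) r r0 Kr.
  by rewrite distrC.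
apply: (@geometric_le0 _ B) => n n0.
have := TB n 1 n0; rewrite ler01 lexx => /(_ isT).
rewrite scale1r opprB addrCA subrr addr0 div1r big1 ?subr0//.
by move=> k _; rewrite c0 !mulr0.
Qed.

Lemma potential_coef_out z k v : ~ O z -> potential_coef z k v = 0.
Proof. by move=> Oz; apply: (annih_har AI); exact: har_ev. Qed.

Lemma small_le0 (x B e : R) : 0 < e ->
  (forall t, 0 < t -> t <= e -> `|x| <= B * t) -> x = 0.
Proof.
move=> e0 h; apply/eqP; rewrite -normr_le0 leNgt; apply/negP => x0.
have B0 : 0 < B.
  have := h e e0 (lexx e); rewrite -(pmulr_lgt0 _ e0); exact: lt_le_trans.
pose t := Num.min e (`|x| / B / 2).
have t0 : 0 < t by rewrite lt_min e0 !divr_gt0.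
have := h t t0; rewrite ge_min lexx => /(_ isT).
have : B * t <= `|x| / 2.
  have : t <= `|x| / B / 2 by rewrite ge_min lexx orbT.
  by rewrite -(ler_pM2l B0); congr (_ <= _); field; rewrite gt_eqF.
lra.
Qed.

(** Uniqueness of Taylor coefficients: once those below [k] vanish, [t^k] times the [k]-th one is
    [O(t^(k+1))] for small [t]. *)
Lemma potential_coef_near z v (r e : R) : 0 < r ->
  (forall x, K x -> r <= `|x - z|) -> 4 * deriv_ratio * `|v| <= r ->
  0 < e -> (forall y, `|y - z| < e -> potential y = 0) ->
  forall k, potential_coef z k v = 0.
Proof.
move=> r0 Kr vr e0 pe.
have [B B0 TB] := taylor_potential r0 Kr vr.
elim/ltn_ind => k IH.
pose e' := Num.min 1 (e / (`|v| + 1)).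
have v1 : 0 < `|v| + 1 by rewrite ltr_pwDr.
suff : k`!%:R^-1 * potential_coef z k v = 0.
  move/eqP; rewrite mulf_eq0 invr_eq0 pnatr_eq0 => /orP[|/eqP//].
  by rewrite eqn0Ngt fact_gt0.
apply: (@small_le0 _ B (e' / 2)).
  by rewrite divr_gt0// lt_min ltr01 divr_gt0.
move=> t t0 te.
have te' : t < e' by apply: (le_lt_trans te); move: t0; lra.
have [t1 tve] : t < 1 /\ t < e / (`|v| + 1) by apply/andP; rewrite -lt_min.
have := TB k.+1 t (ltn0Sn k); rewrite (ltW t0) (ltW t1) => /(_ isT).
rewrite pe ?sub0r ?normrN; last first.
  rewrite addrC addKr normrN normrZ gtr0_norm//.
  move: tve; rewrite ltr_pdivlMr// mulrDr mulr1 => h.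
  by apply: le_lt_trans h; rewrite lerDl ltW.
rewrite big_ord_recr/= big1 ?add0r => [|i _]; last first.
  by rewrite IH// !mulr0.
rewrite mulrCA normrM (ger0_norm (exprn_ge0 _ (ltW t0))) => h.
have tk : 0 < t ^+ k by rewrite exprn_gt0.
rewrite -(ler_pM2l tk) (le_trans h)// mulrCA ler_wpM2l//.
rewrite -exprSr lerXn2r ?nnegrE ?divr_ge0 ?(ltW t0)//; lra.
Qed.

(** The expansion is at [-y] with increment [x], so each partial sum is a harmonic polynomial of
    [x], annihilated exactly, constant term included. The potential is thus zero far away, not
    merely small. *)
Lemma vanish_far : exists2 N : R, 0 < N & forall y, N <= `|y| -> potential y = 0.
Proof.
have [N N0 KN] := compact_norm_bound.
have [C C0 Cb] := annih_bound AI.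
have th4 := deriv_ratio_ge4 hd (R := R).
exists (4 * deriv_ratio * N) => [|y yN]; first by rewrite !mulr_gt0//; lra.
have y0 : 0 < `|y| by apply: lt_le_trans yN; rewrite !mulr_gt0//; lra.
have yN0 : - y != 0 by rewrite -normr_gt0 normrN.
have Ky : ~ K y by move=> /KN; nra.
pose F n x := \sum_(k < n) k`!%:R^-1 * taylor (- y) k Efund x.
apply: (@geometric_le0 _ (C * taylor_cst (d := d) `|y|)) => n n0.
have cT k : continuous_at_pts K (taylor (- y) k Efund).
  by move=> x _; exact: continuous_taylor.
have cF : continuous_at_pts K (F n).
  apply: continuous_pts_sum => k x Kx.
  by apply: continuousM; [exact: cst_continuous | exact: cT].
have cP : continuous_at_pts K (fun x => ev (x - y) Efund) by exact: cont_ev_pts.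
have F0 : I (F n) = 0.
  rewrite annih_sum => [|k x Kx].
    rewrite big1// => k _; rewrite annihZ// (annih_har AI) ?mulr0//.
    exact: har_taylor.
  by apply: continuousM; [exact: cst_continuous | exact: cT].
rewrite -[potential y]subr0 -F0 -annihB// -mulrA; apply: Cb.
- exact: continuous_pts_sub.
- by rewrite mulr_ge0 ?exprn_ge0// /taylor_cst !mulr_ge0 ?exprn_ge0 ?divr_ge0.
move=> x Kx.
have xy : 4 * deriv_ratio * `|x| <= `|- y|.
  rewrite normrN; apply: le_trans yN; rewrite ler_wpM2l ?KN// mulr_ge0//; lra.
have := taylor_Efund hd n0 yN0 xy; rewrite normrN => /le_trans; apply.
apply: ler_wpM2l; first by rewrite /taylor_cst !mulr_ge0 ?exprn_ge0 ?divr_ge0.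
have th0 : 0 <= deriv_ratio :> R by lra.
rewrite lerXn2r ?nnegrE ?mulr_ge0 ?divr_ge0//.
rewrite mulrA ler_pdivrMr//; move: xy; rewrite normrN; lra.
Qed.

End annihilating_functional.

(** * Vanishing of the potential off the hull *)

Section components.
Context {R : realType} {d : nat}.
Local Notation V := 'rV[R]_d.
Implicit Types (A O K : set V) (x y z m : V).

Definition segm x z : set V := (fun t : R => t *: (z - x) + x) @` `[0, 1].

Lemma segm_left x z : segm x z x.
Proof. by exists 0; rewrite /= ?in_itv/= ?lexx ?ler01// scale0r add0r. Qed.

Lemma segm_right x z : segm x z z.
Proof. by exists 1; rewrite /= ?in_itv/= ?lexx ?ler01// scale1r subrK. Qed.

Lemma segm_connected x z : connected (segm x z).
Proof.
apply: connected_continuous_connected; first exact: segment_connected.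
apply: continuous_subspaceT => t; apply: cvgD; last exact: cvg_cst.
by apply: cvgZr_tmp; exact: cvg_id.
Qed.

Lemma segm_ball m (r : R) x z : ball m r x -> ball m r z -> segm x z `<=` ball m r.
Proof.
rewrite -!ball_normE/= => xm zm y [t]; rewrite /= in_itv/= => /andP[t0 t1] <-.
have -> : m - (t *: (z - x) + x) = t *: (m - z) + (1 - t) *: (m - x).
  by apply/rowP => i; rewrite !mxE; ring.
apply: (le_lt_trans (ler_normD _ _)); rewrite !normrZ.
rewrite (ger0_norm t0) ger0_norm ?subr_ge0//.
by have [t2|t2] := lerP t 2^-1; nra.
Qed.

Lemma component_segm A x0 x z : connected_component A x0 x -> segm x z `<=` A ->
  connected_component A x0 z.
Proof.
move=> x0x sA; apply: connected_component_trans x0x _.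
apply: (connected_component_max (segm_left x z) sA (@segm_connected x z)).
exact: segm_right.
Qed.

Lemma component_ball A x0 m (r : R) y : ball m r `<=` A -> ball m r y ->
  connected_component A x0 y -> ball m r `<=` connected_component A x0.
Proof.
move=> mA my x0y z mz; apply: (component_segm x0y).
by apply: subset_trans mA; exact: segm_ball.
Qed.

Lemma component_open A x0 : open A -> open (connected_component A x0).
Proof.
move=> oA; rewrite openE => y x0y.
have Ay := connected_component_sub x0y.
have /nbhs_ballP[r /= r0 rA] : nbhs y A by exact: open_nbhs_nbhs.
apply/nbhs_ballP; exists r => //=.
by apply: component_ball x0y => //; exact: ballxx.
Qed.

Lemma component_closure A x0 y : open A -> A y ->
  closure (connected_component A x0) y -> connected_component A x0 y.
Proof.
move=> oA Ay cy.
have /nbhs_ballP[r /= r0 rA] : nbhs y A by exact: open_nbhs_nbhs.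
have [t [x0t yt]] := cy _ (nbhsx_ballx y r r0).
by apply: (component_ball rA yt x0t); exact: ballxx.
Qed.

Lemma compact_closedV A : compact A -> closed A.
Proof. by apply: compact_closed; exact: norm_hausdorff. Qed.

(** Compactness forces [closure C] into [O], so [C] can be left only through [K]; hence the segment
    need not be assumed to lie in [O]. Its trace on [C] is open and closed in it. *)
Lemma inner_component_segm O K x0 x z : open O -> closed K ->
  compact (closure (connected_component (O `\` K) x0) `&` O) ->
  connected_component (O `\` K) x0 x -> segm x z `<=` ~` K ->
  connected_component (O `\` K) x0 z.
Proof.
move=> oO clK; set C := connected_component _ _ => cD Cx sK.
have oA : open (O `\` K) by apply: openI => //; exact: closed_openC.
have CO : closure C `<=` O.
  move=> y Cy; suff [] : (closure C `&` O) y by [].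
  rewrite [X in X y](closure_id _).1; last exact: compact_closedV.
  move: y Cy; apply: closureS => y Cy; split; first exact: subset_closure.
  by have [] := connected_component_sub Cy.
have E : segm x z `&` C = segm x z.
  apply: (@segm_connected x z).
  - by exists x; split => //; exact: segm_left.
  - by exists C => //; exact: component_open.
  - exists (closure C); first exact: closed_closure.
    apply/seteqP; split=> y [sy Cy]; split => //; first exact: subset_closure.
    by apply: component_closure => //; split; [exact: CO | exact: sK].
have [_ //] : (segm x z `&` C) z by rewrite E; exact: segm_right.
Qed.

Lemma hull_inP O K x : hull_in O K x <-> K x \/ exists x0,
  compact (closure (connected_component (O `\` K) x0) `&` O) /\
  connected_component (O `\` K) x0 x.
Proof.
split=> [[Kx|[C [[x0 _ <-] cC] Cx]]|[Kx|[x0 [cC Cx]]]].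
- by left.
- by right; exists x0.
- by left.
- right; exists (connected_component (O `\` K) x0) => //; split => //.
  exists x0 => //; apply: contrapT => Ax0.
  by move: Cx; rewrite connected_component_out.
Qed.

Lemma compact_hull_in O K : open O -> compact K -> compact (hull_in O K).
Proof.
move=> oO cK; have clK := compact_closedV cK.
have [N N0 KN] := compact_norm_bound cK.
apply: bounded_closed_compact.
  exists N; split; first exact: num_real.
  move=> M NM x /hull_inP[/KN/le_trans|[x0 [cD Cx]]]; first by apply; exact: ltW.
  apply: le_trans (ltW NM); rewrite leNgt; apply/negP => xN.
  have [M' M'0 DM'] := compact_norm_bound cD.
  have x_gt0 : 0 < `|x| by exact: lt_trans xN.
  (* Push [x] radially outwards, beyond the bound [M'] of the component. The path stays outside the
     ball of radius [N] containing [K], so it cannot leave the component. *)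
  pose z := ((`|x| + M' + 1) / `|x|) *: x.
  have zE : `|z| = `|x| + M' + 1.
    by rewrite normrZ ger0_norm ?divfK ?gt_eqF// divr_ge0//; lra.
  have Cz : connected_component (O `\` K) x0 z.
    apply: inner_component_segm Cx _ => // y [t].
    rewrite /= in_itv/= => /andP[t0 t1] <- /KN.
    have -> : t *: (z - x) + x = (1 + t * (M' + 1) / `|x|) *: x.
      by apply/rowP => i; rewrite !mxE; field; rewrite gt_eqF.
    rewrite normrZ ger0_norm; last by rewrite addr_ge0// divr_ge0// mulr_ge0//; lra.
    rewrite mulrDl mul1r divfK ?gt_eqF// leNgt => /negP; apply.
    by apply: (lt_le_trans xN); rewrite lerDl mulr_ge0//; lra.
  have := DM' z; rewrite zE => h.
  have : `|x| + M' + 1 <= M'.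
    apply: h; split; first exact: subset_closure.
    by have [] := connected_component_sub Cz.
  lra.
move=> z Lz; apply/hull_inP; have [Kz|Kz] := pselect (K z); first by left.
have /nbhs_ballP[r /= r0 rK] : nbhs z (~` K).
  by apply: open_nbhs_nbhs; split => //; exact: closed_openC.
have [x [/hull_inP[Kx /rK//|[x0 [cD Cx]]] zx]] := Lz _ (nbhsx_ballx z r r0).
right; exists x0; split => //.
apply: inner_component_segm Cx _ => //.
by apply: subset_trans rK; apply: segm_ball => //; exact: ballxx.
Qed.

End components.

(** * Analytic continuation of the zero potential *)

Section potential_vanishing.
Context {R : realType} {d : nat} (hd : (0 < d)%N).
Local Notation V := 'rV[R]_d.
Local Notation deriv_ratio := (@deriv_ratio R d).
Implicit Types (u v w x y z : V).
Context (O K : set V) (I : (V -> R) -> R).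
Context (openO : open O) (cK : compact K) (KO : K `<=` O) (AI : annihilates O K I).
Local Notation potential := (potential I).

Lemma vanish_near_ball z y (r : R) : 0 < r -> (forall x, K x -> r <= `|x - z|) ->
  (\forall t \near z, potential t = 0) ->
  4 * deriv_ratio * `|y - z| <= r -> potential y = 0.
Proof.
move=> r0 Kr /nbhs_ballP[e /= e0 pe] yr.
apply: (vanish_ball hd cK AI r0 Kr yr) => k.
apply: (potential_coef_near hd cK AI r0 Kr _ e0); first by rewrite distrC.
by move=> t tz; apply: pe; rewrite -ball_normE /= distrC.
Qed.

Lemma vanish_out_ball z y (r : R) : 0 < r -> (forall x, K x -> r <= `|x - z|) ->
  ~ O z -> 4 * deriv_ratio * `|y - z| <= r -> potential y = 0.
Proof.
move=> r0 Kr Oz yr; apply: (vanish_ball hd cK AI r0 Kr yr) => k.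
exact: (potential_coef_out hd openO AI).
Qed.

Lemma deriv_ratio4_gt0 : 0 < 4 * deriv_ratio.
Proof. by have := deriv_ratio_ge4 hd (R := R); lra. Qed.

Lemma vanish_connected (C : set V) y0 : connected C -> C `<=` ~` K -> C y0 ->
  (\forall t \near y0, potential t = 0) -> forall y, C y -> potential y = 0.
Proof.
move=> connC CK Cy0 p0.
pose Z := [set t | potential t = 0]; pose B := C `&` interior Z.
have BC : B = C.
  apply: connC.
  - by exists y0; split.
  - by exists (interior Z) => //; exact: open_interior.
  - exists (closure B); first exact: closed_closure.
    apply/seteqP; split=> y [Cy By]; split => //; first exact: subset_closure.
    have [r r0 Kr] := dist_compact_gt0 cK (CK _ Cy).
    have t4 := deriv_ratio4_gt0; have th4 := deriv_ratio_ge4 hd (R := R).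
    (* The continuation is centred at a nearby [y'], at distance at least [r/2] from [K]. Points
       within [s] of [y] are within [2s] of [y'], and [4 deriv_ratio * 2s = r/2]. *)
    pose s := r / (4 * (4 * deriv_ratio)).
    have s0 : 0 < s by rewrite divr_gt0// mulr_gt0.
    have sE : 4 * deriv_ratio * s = r / 4.
      by rewrite /s; move: (4 * deriv_ratio) t4 => q q0; field; rewrite gt_eqF.
    have sr : s <= r / 2 by have := ler_wpM2r (ltW s0) th4; lra.
    have [y' [[Cy' By'] yy']] := By _ (nbhsx_ballx y s s0).
    move: yy'; rewrite -ball_normE /= => yy'.
    have Kr' x : K x -> r / 2 <= `|x - y'|.
      move=> /Kr; have := ler_distD y' x y; rewrite [`|y' - y|]distrC; lra.
    apply/nbhs_ballP; exists s => //= t; rewrite -ball_normE /= => yt.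
    apply: (vanish_near_ball _ Kr' By'); first by rewrite divr_gt0.
    have : `|t - y'| <= 2 * s.
      have := ler_distD y t y'; rewrite [`|t - y|]distrC; lra.
    nra.
by move=> y; rewrite -BC => -[_ /interior_subset].
Qed.

Lemma vanish_off_hull y : ~ hull_in O K y -> potential y = 0.
Proof.
move=> Ly; have clK := compact_closedV cK.
have Ky : ~ K y by move=> Ky; apply: Ly; left.
have [Oy|Oy] := pselect (O y); last first.
  have [r r0 Kr] := dist_compact_gt0 cK Ky.
  by apply: (vanish_out_ball r0 Kr Oy); rewrite subrr normr0 mulr0 ltW.
set C := connected_component (O `\` K) y.
have Cy : C y by exact: connected_component_refl.
have CA : C `<=` O `\` K by exact: connected_component_sub.
have CK : C `<=` ~` K by move=> t /CA[].
have nD : ~ compact (closure C `&` O).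
  by move=> cD; apply: Ly; apply/hull_inP; right; exists y.
have vC y0 : C y0 -> (\forall t \near y0, potential t = 0) -> potential y = 0.
  by move=> Cy0 p0; apply: (vanish_connected _ CK Cy0 p0) => //; exact: component_connected.
have [N N0 pN] := vanish_far hd openO cK AI.
have [[y0 [Cy0 y0N]]|CN] := pselect (exists y0, C y0 /\ N < `|y0|).
  apply: (vC y0) => //; near=> t; apply: pN; apply: ltW.
  by near: t; apply: (cvgr_norm_gt y0) => //; exact: cvg_id.
have bC : bounded_set (closure C).
  exists N; split; first exact: num_real.
  move=> M NM z Cz; rewrite /= leNgt; apply/negP => zM.
  have : \forall t \near z, N < `|t|.
    apply: (@cvgr_norm_gt _ _ _ (nbhs z) _ id z); first exact: cvg_id.
    exact: lt_trans zM.
  by move=> /Cz[t [Ct Nt]]; apply: CN; exists t.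
(* A bounded component whose closure stayed in [O] would have compact closure in [O] and be filled
   in by the hull. *)
have [z [Cz Oz]] : exists z, closure C z /\ ~ O z.
  apply: contrapT => h; apply: nD.
  have -> : closure C `&` O = closure C.
    apply/seteqP; split=> [t []//|t Ct]; split => //.
    by apply: contrapT => Ot; apply: h; exists t.
  by apply: bounded_closed_compact => //; exact: closed_closure.
have Kz : ~ K z by move=> /KO.
have [r r0 Kr] := dist_compact_gt0 cK Kz.
have t4 := deriv_ratio4_gt0.
have s0 : 0 < r / (4 * deriv_ratio) by rewrite divr_gt0.
have [y0 [Cy0 zy0]] := Cz _ (nbhsx_ballx z _ s0).
apply: (vC y0) => //; apply: filterS (open_near (@ball_open _ _ z _) zy0) => t.
rewrite -ball_normE /= distrC => zt; apply: (vanish_out_ball r0 Kr Oz).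
by rewrite mulrC -ler_pdivlMr// ltW.
Unshelve. all: by end_near. Qed.

End potential_vanishing.

(** * Regularized kernels *)

Section gluing.
Context {R : realType}.
Implicit Types (f g : R -> R) (c s : R).

Definition glue c f g s : R := if s < c then f s else g s.

Lemma near_glue_lt c f g s : s < c -> \forall t \near s, f t = glue c f g t.
Proof.
move=> sc; near=> t; rewrite /glue ifT//.
by near: t; exact: lt_nbhsl.
Unshelve. all: by end_near. Qed.

Lemma near_glue_gt c f g s : c < s -> \forall t \near s, g t = glue c f g t.
Proof.
move=> cs; near=> t; rewrite /glue ifF//; apply/negbTE; rewrite -leNgt ltW//.
by near: t; exact: lt_nbhsr.
Unshelve. all: by end_near. Qed.

Lemma continuous_glue c f g : f c = g c ->
  (forall s, s <= c -> {for s, continuous f}) ->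
  (forall s, c <= s -> {for s, continuous g}) -> continuous (glue c f g).
Proof.
move=> fg cf cg s; have [sc|cs|->] := ltgtP s c.
- by apply: near_continuous (cf _ (ltW sc)); exact: near_glue_lt.
- by apply: near_continuous (cg _ (ltW cs)); exact: near_glue_gt.
- have gc : glue c f g c = g c by rewrite /glue ltxx.
  apply/cvgrPdist_lt => e e0; near=> t; rewrite gc /glue.
  case: ifP => _.
    rewrite -fg; near: t; have /cvgrPdist_lt := cf c (lexx c); exact.
  near: t; have /cvgrPdist_lt := cg c (lexx c); exact.
Unshelve. all: by end_near. Qed.

Lemma is_derive_glue c f g (df dg : R -> R) : f c = g c -> df c = dg c ->
  (forall s, s <= c -> is_derive s 1 f (df s)) ->
  (forall s, c <= s -> is_derive s 1 g (dg s)) ->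
  forall s, is_derive s 1 (glue c f g) (glue c df dg s).
Proof.
move=> fg dfg f' g' s; have [sc|cs|->] := ltgtP s c.
- rewrite -(nbhs_singleton (near_glue_lt df dg sc)).
  by apply: near_eq_is_derive (f' _ (ltW sc)); exact: near_glue_lt.
- rewrite -(nbhs_singleton (near_glue_gt df dg cs)).
  by apply: near_eq_is_derive (g' _ (ltW cs)); exact: near_glue_gt.
(* Caratheodory slopes: those of [f] and [g] at [c] are continuous there with equal values, so
   gluing them gives a continuous slope for the glued function. *)
- have [h [fE ch hc]] := (is_derive1_caratheodory f c _).1 (f' c (lexx c)).
  have [k [gE ck kc]] := (is_derive1_caratheodory g c _).1 (g' c (lexx c)).
  apply/is_derive1_caratheodory; exists (glue c h k); split.
  + move=> z; rewrite /glue ltxx; case: ifP => _; last exact: gE.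
    by rewrite -fg; exact: fE.
  + have hk : h c = k c by rewrite hc kc.
    apply/cvgrPdist_lt => e e0; near=> t; rewrite {1}/glue ltxx /glue.
    case: ifP => _.
      rewrite -hk; near: t; have /cvgrPdist_lt := ch; exact.
    near: t; have /cvgrPdist_lt := ck; exact.
  + by rewrite /glue ltxx kc.
Unshelve. all: by end_near. Qed.

End gluing.

Section regularized_kernel.
Context {R : realType} {d : nat} (hd : (0 < d)%N).
Local Notation V := 'rV[R]_d.
Implicit Types (x y v : V).

(** Profiles are taken in [|x|^2] rather than [|x|], so that the origin needs no separate
    treatment. *)
Lemma radial_function_C2 (g g1 g2 : R -> R) :
  (forall s : R, is_derive s 1 g (g1 s)) -> (forall s : R, is_derive s 1 g1 (g2 s)) ->
  continuous g2 ->
  Ck_on 2 setT (fun x : V => g (dot x x)) /\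
  forall x : V, laplacian (fun x => g (dot x x)) x =
    4 * dot x x * g2 (dot x x) + 2 * d%:R * g1 (dot x x).
Proof.
move=> dg dg1 cg2.
have c_of (h h' : R -> R) : (forall s : R, is_derive s 1 h (h' s)) -> continuous h.
  by move=> dh s; have [dh' _] := dh s; exact/differentiable_continuous/derivable1_diffP.
have csq (h : R -> R) x : continuous h -> {for x, continuous (fun x : V => h (dot x x))}.
  move=> ch; apply: (@continuous_comp _ _ _ (fun x : V => dot x x) h).
    exact: continuous_sqnorm.
  exact: ch.
have cc (i : 'I_d) x : {for x, continuous (fun x : V => x 0 i)} by exact: coord_continuous.
have [|x _|i x _|i j x _|i x _|i j x _|C2 lapE] := @Ck_on_2I R d setT (fun x : V => g (dot x x))
  (fun i x => g1 (dot x x) * (2 * x 0 i))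
  (fun i j x => g2 (dot x x) * (2 * x 0 j) * (2 * x 0 i)
                + g1 (dot x x) * (2 * (delta_mx 0 j : V) 0 i)).
- exact: openT.
- by apply: csq; exact: c_of dg.
- apply: continuousM; first by apply: csq; exact: c_of dg1.
  by apply: continuousM; [exact: cst_continuous | exact: cc].
- apply: (@continuousD R R^o).
    apply: continuousM; [apply: continuousM; first exact: csq|];
    by apply: continuousM; [exact: cst_continuous | exact: cc].
  apply: continuousM; last exact: cst_continuous.
  by apply: csq; exact: c_of dg1.
- have := @is_derive_comp1 R V g (fun x => dot x x) x (delta_mx 0 i) _ _ (dg _)
    (is_derive_sqnorm x _).
  by rewrite dot_delta.
- apply: is_derive_mul.
    have := @is_derive_comp1 R V g1 (fun x => dot x x) x (delta_mx 0 j) _ _ (dg1 _)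
      (is_derive_sqnorm x _).
    by rewrite dot_delta.
  by apply: is_deriveZ; exact: is_derive_coord.
- split=> // x; rewrite lapE//.
  transitivity (\sum_(i < d) (4 * g2 (dot x x) * (x 0 i * x 0 i) + 2 * g1 (dot x x))).
    by apply: eq_bigr => i _; rewrite mxE !eqxx /=; ring.
  rewrite big_split /= -mulr_sumr sumr_const card_ord -/(dot x x) -mulr_natl.
  ring.
Qed.

Lemma is_derive_radial_sqrt (s : R) : 0 < s ->
  is_derive s 1 (fun s => radial (d := d) (Num.sqrt s))
    (2^-1 * (Num.sqrt s)^-1 ^+ d).
Proof.
move=> s0; have q0 : 0 < Num.sqrt s by rewrite sqrtr_gt0.
have := is_derive1_comp (is_derive_radial hd q0) (is_derive1_sqrt s0).
congr is_derive; rewrite invfM; field; rewrite gt_eqF//.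
Qed.

Lemma is_derive_radial_sqrt2 (s : R) : 0 < s ->
  is_derive s 1 (fun s => 2^-1 * (Num.sqrt s)^-1 ^+ d)
    (- (d%:R / 4) * (Num.sqrt s)^-1 ^+ d.+2).
Proof.
move=> s0; have q0 : 0 < Num.sqrt s by rewrite sqrtr_gt0.
have := is_deriveZ (2^-1 : R)
  (is_derive1_comp (is_derive_invX d q0) (is_derive1_sqrt s0)).
congr is_derive; rewrite /GRing.scale/= !exprS invfM; field.
by rewrite gt_eqF.
Qed.

(* Outside the Euclidean ball of radius [e] the kernel is the fundamental
   solution, a function of [|x|^2]; inside, this function is replaced by its
   second order Taylor polynomial at [e^2]. *)
Lemma regularized_kernel (e : R) : 0 < e -> exists E : V -> R,
  [/\ Ck_on 2 setT E,
      forall x, e <= `|x| -> E x = ev x Efund,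
      forall x, 0 <= laplacian E x,
      forall x, e <= `|x| -> laplacian E x = 0 &
      exists m r : R, [/\ 0 < m, 0 < r & forall x, `|x| <= r -> m <= laplacian E x]].
Proof.
move=> e0; pose c := e ^+ 2.
have c0 : 0 < c by rewrite exprn_gt0.
have sc : Num.sqrt c = e by rewrite sqrtr_sqr gtr0_norm.
have sqrt_gt0 s : c <= s -> 0 < s by apply: lt_le_trans.
pose g (s : R) := radial (d := d) (Num.sqrt s).
pose g' (s : R) := 2^-1 * (Num.sqrt s)^-1 ^+ d.
pose g'' (s : R) := - (d%:R / 4) * (Num.sqrt s)^-1 ^+ d.+2.
pose q (s : R) := g c + (g' c * (s - c) + g'' c * powfact 2 (s - c)).
pose q' (s : R) := g' c + g'' c * (s - c).
have dB (s : R) : is_derive s 1 (fun s => s - c) 1.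
  by rewrite -[X in is_derive _ _ _ X]subr0; apply: is_deriveB.
have dq (s : R) : is_derive s 1 q (q' s).
  rewrite /q /q' -[X in is_derive _ _ _ X]add0r; apply: is_derive_add.
  apply: is_derive_add.
    by rewrite -[X in is_derive _ _ _ X]mulr1; apply: is_deriveZ; exact: dB.
  apply: is_deriveZ.
  have := @is_derive1_comp R (powfact 2) (fun s => s - c) s _ _
    (is_derive_powfactS 1 (s - c)) (dB s).
  by rewrite /powfact !(expr1, mulr1, invr1, mul1r).
have dq' (s : R) : is_derive s 1 q' (g'' c).
  rewrite -[X in is_derive _ _ _ X]add0r; apply: is_derive_add.
  by rewrite -[X in is_derive _ _ _ X]mulr1; apply: is_deriveZ; exact: dB.
have qc : q c = g c.
  by rewrite /q /powfact subrr expr0n !mulr0 !addr0.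
have qc' : q' c = g' c by rewrite /q' subrr mulr0 addr0.
have dG : forall s : R, is_derive s 1 (glue c q g) (glue c q' g' s).
  by apply: is_derive_glue => // s /sqrt_gt0; exact: is_derive_radial_sqrt.
have dG' : forall s : R, is_derive s 1 (glue c q' g') (glue c (fun=> g'' c) g'' s).
  by apply: is_derive_glue => // s /sqrt_gt0; exact: is_derive_radial_sqrt2.
have cG'' : continuous (glue c (fun=> g'' c) g'').
  apply: continuous_glue => // s; first by move=> _; exact: cst_continuous.
  move=> /sqrt_gt0 s0; apply: continuousM; first exact: cst_continuous.
  apply: (@continuous_comp _ _ _ Num.sqrt (fun t : R => t^-1 ^+ d.+2)).
    exact: sqrt_continuous.
  have qs0 : 0 < Num.sqrt s by rewrite sqrtr_gt0.
  by have [dh _] := is_derive_invX d.+2 qs0; exact/differentiable_continuous/derivable1_diffP.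
have [C2 lapE] := radial_function_C2 dG dG' cG''.
(* Inside, [4 s q''(s) + 2 d q'(s)] is affine in [s = |x|^2] and vanishes at [s = c], where it
   matches the harmonic exterior. Its slope is [-k], so the Laplacian is [k (c - s)]. *)
pose k := (d%:R + 2) * (d%:R / 2) * e^-1 ^+ d.+2.
have dR0 : 0 < d%:R :> R by rewrite ltr0n.
have k0 : 0 < k.
  apply: mulr_gt0; last by rewrite exprn_gt0// invr_gt0.
  by apply: mulr_gt0; [rewrite addr_gt0 | rewrite divr_gt0].
have lap_lt x : dot x x < c ->
    laplacian (fun x : V => glue c q g (dot x x)) x = k * (c - dot x x).
  move=> xc; rewrite lapE /glue xc /q' /g' /g'' /k sc /c !exprS.
  by field; rewrite gt_eqF.
have lap_ge x : c <= dot x x ->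
    laplacian (fun x : V => glue c q g (dot x x)) x = 0.
  move=> xc; rewrite lapE /glue ltNge xc /= /g' /g'' !exprS.
  have s0 := sqrt_gt0 _ xc.
  rewrite -{1}[dot x x]sqr_sqrtr ?ltW//.
  by field; rewrite gt_eqF// sqrtr_gt0.
have far x : e <= `|x| -> c <= dot x x.
  move=> ex; apply: le_trans (norm_le_dot x).
  by rewrite lerXn2r ?nnegrE// ltW.
exists (fun x : V => glue c q g (dot x x)); split => //.
- by move=> x /far xc; rewrite /glue ltNge xc.
- move=> x; have [xc|xc] := ltP (dot x x) c; last by rewrite lap_ge.
  by rewrite lap_lt// mulr_ge0 ?subr_ge0// ltW.
- by move=> x /far; exact: lap_ge.
(* On this sup-norm ball [|x|^2] is at most [d (e/(2d))^2 = c/(4d)], hence at most [c/2]. *)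
- exists (k * (c / 2)), (e / (2 * d%:R)); split.
  + by rewrite mulr_gt0// divr_gt0.
  + by rewrite divr_gt0// mulr_gt0.
  + move=> x xr.
    have xc : dot x x <= c / 2.
      rewrite (le_trans (ler_norm _))// (le_trans (dot_le_norm _ _))//.
      have d1 : 1 <= d%:R :> R by rewrite ler1n.
      have : `|x| * `|x| <= (e / (2 * d%:R)) * (e / (2 * d%:R)) by exact: ler_pM.
      rewrite -(ler_pM2l dR0) => /le_trans; apply.
      have -> : d%:R * (e / (2 * d%:R) * (e / (2 * d%:R))) = c / 2 * (2 * d%:R)^-1.
        by rewrite /c; field; rewrite gt_eqF.
      rewrite ler_piMr ?divr_ge0 ?(ltW c0)// invf_le1 ?mulr_gt0//; lra.
    rewrite lap_lt; last by move: c0 xc; lra.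
    by rewrite ler_wpM2l ?(ltW k0)//; lra.
Qed.

End regularized_kernel.

(** * Lattice approximation *)

Section compact_uniformity.
Context {R : realType} {d : nat}.
Local Notation V := 'rV[R]_d.
Implicit Types (A U : set V) (f g : V -> R) (x y : V).

(** A Lebesgue number argument. Only [y] ranges over [A]; [t] may leave it, as thickenings of [A]
    require. *)
Lemma compact_uniform A (Q : V -> V -> Prop) : compact A ->
  (forall x, A x -> exists2 r : R, 0 < r &
     forall y t, `|y - x| < r -> `|t - x| < r -> Q y t) ->
  exists2 r : R, 0 < r & forall y t, A y -> `|t - y| < r -> Q y t.
Proof.
move=> /compact_near_coveringP cA AQ.
have := cA R (nbhs (0:R)^'+) (fun r y => forall t, `|t - y| < r -> Q y t) _.
move=> /(_ _)[].
- move=> x /AQ[r r0 rQ].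
  exists (ball x (r / 2), [set s : R | s < r / 2]); first split.
  + by apply: nbhsx_ballx; rewrite divr_gt0.
  + by apply: nbhs_right_lt; rewrite divr_gt0.
  + move=> [y s] /= [xy sr] t ty; move: xy; rewrite -ball_normE /= distrC => yx.
    apply: rQ; first by apply: lt_trans yx _; lra.
    have := ler_distD y t x; lra.
- move=> r /= r0 rA; pose s := r / 2.
  have s0 : 0 < s by rewrite divr_gt0.
  exists s => // y t Ay; apply: rA => //=.
  by rewrite sub0r normrN gtr0_norm// /s; lra.
Qed.

Lemma unif_continuous_compact A g (e : R) : compact A ->
  (forall x, A x -> {for x, continuous g}) -> 0 < e ->
  exists2 r : R, 0 < r & forall y t, A y -> `|t - y| < r -> `|g t - g y| < e.
Proof.
move=> cA cg e0; apply: compact_uniform => // x /cg /cvgrPdist_lt /(_ (e / 2)).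
move=> /(_ _)/nbhs_ballP[]; first by rewrite divr_gt0.
move=> r /= r0 rg; exists r => // y t yx tx.
have := rg y; have := rg t; rewrite -ball_normE /= [`|x - t|]distrC [`|x - y|]distrC tx yx.
move=> /(_ isT) h1 /(_ isT) h2.
have := ler_distD (g x) (g t) (g y); rewrite [`|g t - g x|]distrC; lra.
Qed.

Lemma compact_thickening A U : compact A -> open U -> A `<=` U ->
  exists2 r : R, 0 < r & forall y t, A y -> `|t - y| < r -> U t.
Proof.
move=> cA oU AU; apply: compact_uniform => // x /AU Ux.
have /nbhs_ballP[r /= r0 rU] : nbhs x U by exact: open_nbhs_nbhs.
exists r => // y t _ tx; apply: rU; by rewrite -ball_normE /= distrC.
Qed.

Lemma bounded_on_compact A g : compact A ->
  (forall x, A x -> {for x, continuous g}) ->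
  exists2 M : R, 0 <= M & forall x, A x -> `|g x| <= M.
Proof.
move=> cA cg.
have cgA : compact (g @` A).
  apply: continuous_compact => //; apply: continuous_in_subspaceT => x.
  by rewrite inE => /cg.
have /compact_bounded[M [_ gM]] := cgA.
exists (`|M| + 1) => [|x Ax]; first by rewrite addr_ge0.
have MM : M < `|M| + 1 by rewrite (le_lt_trans (ler_norm M))// ltrDl.
by apply: (gM _ MM); exists x.
Qed.

(** [h^2] times the discrete Laplacian. *)
Definition sdiff (h : R) f x : R :=
  \sum_i (f (x + h *: delta_mx 0 i) + f (x - h *: delta_mx 0 i) - 2 * f x).

Lemma norm_scale_delta (h : R) (i : 'I_d) : `|h *: delta_mx 0 i : V| <= `|h|.
Proof.
apply: norm_le_coord => // j; rewrite !mxE eqxx /=.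
by case: eqP => _; rewrite ?mulr1// mulr0 normr0.
Qed.

(** [s] is a sign: adding the cases [1] and [-1] cancels the first-order terms in
    [sdiff_laplacian]. *)
Lemma second_order_taylor f (i : 'I_d) x (h s e : R) :
  0 < h -> s ^+ 2 = 1 ->
  (forall t : R, 0 <= t <= h -> is_derive ((s * t) *: delta_mx 0 i + x) (delta_mx 0 i)
    f (partial i f ((s * t) *: delta_mx 0 i + x))) ->
  (forall t : R, 0 <= t <= h -> is_derive ((s * t) *: delta_mx 0 i + x) (delta_mx 0 i)
    (partial i f) (partial i (partial i f) ((s * t) *: delta_mx 0 i + x))) ->
  (forall t : R, 0 <= t <= h ->
    `|partial i (partial i f) ((s * t) *: delta_mx 0 i + x)
      - partial i (partial i f) x| <= e) ->
  `|f ((s * h) *: delta_mx 0 i + x) - f x - h * (s * partial i f x)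
    - h ^+ 2 / 2 * partial i (partial i f) x| <= e * (h ^+ 2 / 2).
Proof.
move=> h0 s2 d1 d2 d2e; set c := partial i (partial i f) x.
pose p (t : R) : V := (s * t) *: delta_mx 0 i + x.
have line (g g' : V -> R) (t : R) : is_derive (p t) (delta_mx 0 i) g (g' (p t)) ->
    is_derive t 1 (fun t => g (p t)) (s * g' (p t)).
  move=> /is_derive_lineP dg; apply/is_derive_lineP.
  have := @is_derive1_comp R (fun u : R => g (u *: delta_mx 0 i + p t))
    (fun u => s * u) 0 (g' (p t)) s.
  rewrite mulr0 mulrC => /(_ dg) H.
  have ds : is_derive (0:R) 1 (fun u => s * u) s.
    by rewrite -[X in is_derive _ _ _ X]mulr1; apply: is_deriveZ; exact: is_derive_id.
  have {H} := H ds; congr is_derive.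
  apply/funext => u /=; congr g; apply/rowP => k; rewrite /p [_%:A]mulr1 !mxE; ring.
pose F (k : nat) (t : R) : R := match k with
  | 0%N => f (p t) - c * powfact 2 t
  | 1%N => s * partial i f (p t) - c * powfact 1 t
  | _ => partial i (partial i f) (p t) - c * powfact 0 t end.
have f0 : 0`!%:R = 1 :> R by [].
have dF (k : nat) (t : R) : (k < 2)%N -> 0 <= t <= h ->
    is_derive t 1 (F k) (F k.+1 t).
  have dc m : is_derive t 1 (fun t => c * powfact m.+1 t) (c * powfact m t).
    by apply: is_deriveZ; exact: is_derive_powfactS.
  case: k => [|[|//]] _ th; rewrite /F.
    by apply: is_deriveB (line _ _ _ (d1 t th)) (dc 1%N).
  apply: (@is_deriveB _ _ _ (fun t => s * partial i f (p t)) _ _ _ _ _ _ (dc 0%N)).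
  have := is_deriveZ s (line _ _ _ (d2 t th)).
  by congr is_derive; rewrite /GRing.scale/= mulrA -expr2 s2 mul1r.
have FM (t : R) : 0 <= t <= h -> `|F 2%N t| <= e.
  by move=> th; rewrite /F /powfact f0 expr0 invr1 !mulr1; exact: d2e.
have := @taylor_remainder R 2 F h e dF FM h.
rewrite lexx (ltW h0) => /(_ isT).
rewrite big_ord_recr/= big_ord_recr/= big_ord0 /F /=.
have p0 : p 0 = x by rewrite /p mulr0 scale0r add0r.
have pf k : powfact k 0 = (k == 0%N)%:R :> R.
  rewrite /powfact expr0n; case: k => [|k] /=; last by rewrite mulr0.
  by rewrite f0 invr1 mulr1.
have pf2 (t : R) : powfact 2 t = t ^+ 2 / 2 by rewrite /powfact mulrC.
have pf1 (t : R) : powfact 1 t = t by rewrite /powfact invr1 mul1r.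
have pf0 (t : R) : powfact 0 t = 1 by rewrite /powfact f0 expr0 invr1 mulr1.
rewrite p0 !pf /= !pf2 pf1 pf0 !mulr0 !subr0 !mulr1 add0r -/(p h).
congr (`|_| <= _); ring.
Qed.

Lemma sdiff_laplacian A U f (e : R) : (0 < d)%N -> open U -> compact A ->
  A `<=` U -> Ck_on 2 U f -> 0 < e ->
  exists2 h0 : R, 0 < h0 & forall h x, 0 < h -> h < h0 -> A x ->
    `|sdiff h f x - h ^+ 2 * laplacian f x| <= e * h ^+ 2.
Proof.
move=> hd oU cA AU [cf Cf] e0.
have [r r0 rU] := compact_thickening cA oU AU.
have ed : 0 < e / d%:R by rewrite divr_gt0// ltr0n.
have unif i : exists2 s : R, 0 < s & forall y t, A y -> `|t - y| < s ->
    `|partial i (partial i f) t - partial i (partial i f) y| < e / d%:R.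
  apply: unif_continuous_compact => // x Ax.
  have [_ [_ /(_ i)[_ [+ _]]]] := Cf i.
  by apply; exact: AU.
pose s i := sval (cid2 (unif i)).
have s0 i : 0 < s i by rewrite /s; case: cid2.
have su i y t : A y -> `|t - y| < s i ->
    `|partial i (partial i f) t - partial i (partial i f) y| < e / d%:R.
  by rewrite /s; case: cid2 => /= ? ? H; exact: H.
exists (\big[Num.min/r]_i s i) => [|h x h0 hr Ax].
  by apply/bigmin_gtP; split.
move: hr => /bigmin_gtP[hr hs].
rewrite /sdiff /laplacian mulr_sumr -sumrB.
apply: (le_trans (ler_norm_sum _ _ _)).
have -> : e * h ^+ 2 = \sum_(i < d) (e / d%:R * h ^+ 2).
  rewrite sumr_const card_ord -mulr_natl; field.
  by rewrite gt_eqF// ltr0n.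
apply: ler_sum => i _.
have hsi : h < s i by exact: hs.
have near_x (sg t : R) : sg ^+ 2 = 1 -> 0 <= t <= h ->
    `|(sg * t) *: delta_mx 0 i + x - x| <= h.
  move=> sg2 /andP[t0 th]; rewrite addrK (le_trans (norm_scale_delta _ _))// normrM.
  have -> : `|sg| = 1.
    by apply/eqP; rewrite -sqrp_eq1// real_normK ?num_real// sg2.
  by rewrite mul1r ger0_norm.
have T (sg : R) : sg ^+ 2 = 1 ->
  `|f ((sg * h) *: delta_mx 0 i + x) - f x - h * (sg * partial i f x)
    - h ^+ 2 / 2 * partial i (partial i f) x| <= e / d%:R * (h ^+ 2 / 2).
  move=> sg2; apply: second_order_taylor => // t th.
  - have [D1 _] := Cf i; apply: derivableP; apply: D1; apply: (rU x) => //.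
    exact: le_lt_trans (near_x _ _ sg2 th) hr.
  - have [_ [_ /(_ i)[D2 _]]] := Cf i; apply: derivableP; apply: D2; apply: (rU x) => //.
    exact: le_lt_trans (near_x _ _ sg2 th) hr.
  - by apply/ltW/su => //; apply: le_lt_trans hsi; exact: near_x.
have := T 1 (expr1n _ _); have := T (-1) (etrans (sqrrN 1) (expr1n _ _)).
rewrite mul1r !mulN1r scaleNr [- _ + x]addrC [_ *: _ + x]addrC.
set a := f (x + _); set b := f (x - _); set c := partial i (partial i f) x.
set p := partial i f x.
rewrite !ler_norml => /andP[? ?] /andP[? ?]; apply/andP; split; lra.
Qed.

End compact_uniformity.

(** * Translation and summation by parts on a finite cubic lattice *)

Section lattice_sums.
Context {R : realType} {d : nat} (N : nat) (h : R) (h0 : 0 < h).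
Local Notation V := 'rV[R]_d.
Local Notation J := {ffun 'I_d -> 'I_(N.*2.+1)}.
Implicit Types (u A B : V -> R) (x y : V) (j : J) (i : 'I_d).

Definition lpt j : V := \row_i (h * ((j i)%:R - N%:R)).

Lemma norm_lpt j : `|lpt j| <= h * N%:R.
Proof.
apply: norm_le_coord => [|i]; first by rewrite mulr_ge0// ltW.
rewrite mxE normrM gtr0_norm// ler_wpM2l ?(ltW h0)// ler_norml.
have : (j i <= N + N)%N by rewrite addnn -ltnS ltn_ord.
rewrite -(ler_nat R) natrD.
have : 0 <= (j i)%:R :> R by [].
lra.
Qed.

Definition lshift i j : J := [ffun k => if k == i then ordS (j k) else j k].

Lemma lshift_bij i : bijective (lshift i).
Proof.
exists (fun j => [ffun k => if k == i then ord_pred (j k) else j k]) => j;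
  by apply/ffunP => k; rewrite !ffunE; case: (k == i); rewrite ?ordSK ?ord_predK.
Qed.

(* The shift is cyclic; wrapping around is harmless because [u] vanishes there. *)
Lemma lattice_shift i u : (forall y, h * N%:R <= `|y| -> u y = 0) ->
  \sum_j u (lpt j + h *: delta_mx 0 i) = \sum_j u (lpt j).
Proof.
move=> u0; rewrite [RHS](reindex (lshift i)); last exact/onW_bij/lshift_bij.
apply: eq_bigr => j _; have [ji|ji] := ltnP (j i) N.*2.
  congr u; apply/rowP => k; rewrite !mxE !ffunE eqxx /=.
  case: eqP => [->|_] /=; last by rewrite mulr0 addr0.
  by rewrite modn_small ?ltnS// -natr1; ring.
have jiE : (j i : nat) = N.*2 by apply/eqP; rewrite eqn_leq ji -ltnS ltn_ord.
rewrite !u0//.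
- apply: le_trans (norm_coord _ i).
  rewrite !mxE !ffunE eqxx /= jiE modnn sub0r mulrN normrN.
  by rewrite ger0_norm// mulr_ge0// ltW.
- apply: le_trans (norm_coord _ i); rewrite !mxE !eqxx jiE -addnn natrD /=.
  rewrite addrK mulr1 ger0_norm ?lerDl ?(ltW h0)// addr_ge0 ?(ltW h0)//.
  by rewrite mulr_ge0// ltW.
Qed.

(** Discrete Green identity by translating each sum one mesh step. Only [B] must vanish near the
    boundary of the cube, with a margin [h] for the backward shift. *)
Lemma lattice_parts A B : (forall y, h * N%:R <= `|y| + h -> B y = 0) ->
  \sum_j A (lpt j) * sdiff h B (lpt j) = \sum_j sdiff h A (lpt j) * B (lpt j).
Proof.
move=> B0; rewrite /sdiff.
under eq_bigr do rewrite mulr_sumr.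
under [RHS]eq_bigr do rewrite mulr_suml.
rewrite exchange_big [RHS]exchange_big; apply: eq_bigr => i _ /=.
set e := h *: delta_mx 0 i.
have ne : `|e| <= h by rewrite (le_trans (norm_scale_delta _ _))// gtr0_norm.
have E1 : \sum_j A (lpt j) * B (lpt j + e) = \sum_j A (lpt j - e) * B (lpt j).
  rewrite -(@lattice_shift i (fun y => A (y - e) * B y)).
    by apply: eq_bigr => j _; rewrite addrK.
  by move=> y yN; rewrite B0 ?mulr0// (le_trans yN)// lerDl ltW.
have E2 : \sum_j A (lpt j) * B (lpt j - e) = \sum_j A (lpt j + e) * B (lpt j).
  rewrite -(@lattice_shift i (fun y => A y * B (y - e))).
    by apply: eq_bigr => j _; rewrite addrK.
  move=> y yN; rewrite B0 ?mulr0// (le_trans yN)//.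
  have := ler_normD (y - e) e; rewrite subrK; lra.
under eq_bigr do rewrite mulrBr mulrDr.
under [RHS]eq_bigr do rewrite mulrBl mulrDl.
rewrite !sumrB !big_split /= E1 E2 [X in X - _]addrC; congr (_ - _).
by apply: eq_bigr => j _; ring.
Qed.

Definition ivec (k : {ffun 'I_d -> nat}) : V := \row_i (h * (k i)%:R).

(** Unit shifts are applied one at a time, by induction on the sum of the [k i]; vanishing is
    required for all [k' <= k] because every intermediate translate must miss the boundary. *)
Lemma lattice_shift_ivec (k : {ffun 'I_d -> nat}) u :
  (forall (k' : {ffun 'I_d -> nat}) y, (forall i, k' i <= k i)%N ->
     h * N%:R <= `|y| -> u (y + ivec k') = 0) ->
  \sum_j u (lpt j + ivec k) = \sum_j u (lpt j).
Proof.
move: {2}(\sum_i k i)%N (erefl (\sum_i k i)%N) => n.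
elim: n k => [|n IHn] k kn u0.
  apply: eq_bigr => j _; congr u; apply/rowP => i; rewrite !mxE.
  have /eqP := kn; rewrite sum_nat_eq0 => /forallP/(_ i); rewrite implyTb => /eqP ->.
  by rewrite mulr0 addr0.
have [i ki] : exists i, (0 < k i)%N.
  apply/existsP; apply: contra_eqT kn => /existsPn k0.
  rewrite big1// => i _; apply/eqP; rewrite -leqn0 leqNgt; exact: k0.
pose k1 : {ffun 'I_d -> nat} := [ffun l => if l == i then (k l).-1 else k l].
have k1k l : (k1 l <= k l)%N by rewrite ffunE; case: ifP => // _; exact: leq_pred.
have kE : ivec k = ivec k1 + h *: delta_mx 0 i.
  apply/rowP => l; rewrite !mxE ffunE eqxx /=.
  case: eqP => [->|_] /=; last by rewrite mulr0 addr0.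
  by rewrite -{1}(prednK ki) -natr1 mulrDr.
transitivity (\sum_j u (lpt j + ivec k1)).
  rewrite -(@lattice_shift i (fun y => u (y + ivec k1))).
    by apply: eq_bigr => j _; rewrite kE addrA addrAC.
  by move=> y yN; apply: u0.
apply: IHn => [|k' y k'k1 yN]; last first.
  by apply: u0 => // l; exact: leq_trans (k'k1 l) _.
apply/eqP; rewrite -eqSS -kn [X in _ == X](bigD1 i)//= (bigD1 i)//= ffunE eqxx.
rewrite -addSn prednK// eqn_add2l; apply/eqP; apply: eq_bigr => l li.
by rewrite ffunE (negbTE li).
Qed.

End lattice_sums.

Section lattice_kernel_sum.
Context {R : realType} {d : nat} (N : nat) (h : R) (h0 : 0 < h).
Local Notation V := 'rV[R]_d.
Local Notation J := {ffun 'I_d -> 'I_(N.*2.+1)}.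
Context (psi : V -> R) (e : R) (psi0 : forall x, e <= `|x| -> psi x = 0).
Local Notation lpt := (@lpt R d N h).

(** Replaces translation invariance of the integral of [psi]: a shift by a lattice vector leaves the
    sum unchanged, and rounding [x] to such a shift costs at most [s] per term. *)
Lemma lattice_sum_const (M s : R) : 0 <= M -> 0 <= s -> M + e <= h * N%:R ->
  (forall y t : V, `|y| <= M + h * N%:R -> `|t - y| <= h -> `|psi t - psi y| <= s) ->
  forall x : V, `|x| <= M ->
  `|\sum_j psi (x - lpt j) - \sum_j psi (- lpt j)| <= 2 * (#|{: J}|%:R * s).
Proof.
move=> M0 s0 MN osc.
(* The reference point is a corner, so that [x - x0] has nonnegative coordinates, rounded down to
   natural multiples of [h]. Comparing both [x] and 0 with it gives the factor 2. *)
pose x0 : V := \row_i (- M).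
suff main x : `|x| <= M ->
    `|\sum_j psi (x - lpt j) - \sum_j psi (x0 - lpt j)| <= #|{: J}|%:R * s.
  move=> x xM; have := main x xM; have := main 0; rewrite normr0 => /(_ M0).
  under eq_bigr do rewrite sub0r.
  move=> h1 h2; rewrite -(subrKA (\sum_j psi (x0 - lpt j))).
  apply: (le_trans (ler_normD _ _)); rewrite [X in _ + X <= _]distrC; lra.
move=> xM.
pose k : {ffun 'I_d -> nat} := [ffun i => Num.truncn ((x 0 i + M) / h)].
have xi i : - M <= x 0 i <= M by rewrite -ler_norml (le_trans (norm_coord _ _)).
have ki i : h * (k i)%:R <= x 0 i + M < h * (k i)%:R + h.
  have xM0 : 0 <= (x 0 i + M) / h.
    by rewrite divr_ge0 ?(ltW h0)//; have := xi i; lra.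
  have := truncn_itv xM0; rewrite /k ffunE -natr1 ler_pdivlMr// ltr_pdivrMr//.
  by move: (Num.truncn _) => n; rewrite mulrDl mul1r mulrC.
have -> : \sum_j psi (x0 - lpt j) = \sum_j psi (x0 + ivec h k - lpt j).
  have := @lattice_shift_ivec R d N h h0 k (fun y => psi (x0 + ivec h k - y)).
  move=> <-; first by apply: eq_bigr => j _; congr psi; rewrite opprD addrA addrAC addrK.
  move=> k' y k'k yN; apply: psi0.
  have : `|x0 + ivec h k - ivec h k'| <= M.
    apply: norm_le_coord => // i; rewrite !mxE ler_norml.
    have := k'k i; rewrite -(ler_nat R) => k'ki.
    have := ki i; have := xi i; have : 0 <= h * (k' i)%:R by rewrite mulr_ge0// ltW.
    have : h * (k' i)%:R <= h * (k i)%:R by rewrite ler_wpM2l// ltW.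
    lra.
  have -> : x0 + ivec h k - (y + ivec h k') = (x0 + ivec h k - ivec h k') - y.
    by apply/rowP => i; rewrite !mxE; ring.
  have := lerB_dist y (x0 + ivec h k - ivec h k').
  rewrite distrC; lra.
rewrite -sumrB; apply: (le_trans (ler_norm_sum _ _ _)).
apply: (@le_trans _ _ (\sum_(j : J) s)).
  apply: ler_sum => j _; rewrite distrC; apply: osc.
    apply: (le_trans (ler_normB _ _)); rewrite lerD//; exact: norm_lpt.
  rewrite [X in `|X|](_ : _ = x0 + ivec h k - x); last first.
    by apply/rowP => i; rewrite !mxE; ring.
  apply: norm_le_coord => [|i]; first exact: ltW.
  have := ki i; rewrite !mxE ler_norml; lra.
by rewrite sumr_const mulr_natl.
Qed.

Lemma lattice_sum_lower (m r : R) (q : nat) : (0 < q)%N -> (q <= N)%N ->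
  h * q%:R <= r -> 0 < m -> (forall x, 0 <= psi x) ->
  (forall x : V, `|x| <= r -> m <= psi x) ->
  m * (q ^ d)%:R <= \sum_j psi (- lpt j).
Proof.
move=> q0 qN hr m0 psi_ge0 psi_m.
(* One orthant suffices: [q] indices per coordinate give [q^d] lattice points with coordinates
   between 0 and [h q]. *)
pose B := [pred a : 'I_(N.*2.+1) | (N <= a < N + q)%N].
pose P := [pred j : J | j \in ffun_on B].
have Bq : (q <= #|B|)%N.
  pose f (a : 'I_q) : 'I_(N.*2.+1) := inord (N + a).
  have fE a : f a = (N + a)%N :> nat.
    rewrite inordK// ltnS -addnn leq_add2l; apply: leq_trans qN.
    exact: ltnW.
  have finj : injective f.
    by move=> a b /(congr1 (fun c : 'I_ _ => (c : nat))); rewrite !fE => /addnI/val_inj.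
  rewrite -[leqLHS]card_ord -(card_codom finj); apply: subset_leq_card.
  apply/fintype.subsetP => _ /codomP[a ->].
  by rewrite inE /= fE leq_addr ltn_add2l ltn_ord.
rewrite (bigID P)/= -[leLHS]addr0 lerD//; last by apply: sumr_ge0.
apply: (@le_trans _ _ (\sum_(j in P) m)).
  rewrite sumr_const -[leRHS]mulr_natr ler_wpM2l ?(ltW m0)// ler_nat.
  have -> : #|P| = (#|B| ^ d)%N.
    by rewrite -[X in (_ ^ X)%N]card_ord -card_ffun_on; apply: eq_card => j; rewrite inE.
  by have [->|dp] := posnP d; rewrite ?expn0 ?leq_exp2r.
apply: ler_sum => j /ffun_onP jB; apply: psi_m.
rewrite normrN; apply: le_trans hr; apply: norm_le_coord => [|i].
  by rewrite mulr_ge0// ltW.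
rewrite mxE normrM gtr0_norm// ler_wpM2l ?(ltW h0)//.
have := jB i; rewrite inE => /andP[].
rewrite -(ler_nat R) => h1 /ltnW; rewrite -(ler_nat R) natrD => h2.
rewrite ger0_norm; lra.
Qed.

End lattice_kernel_sum.

(** * The functional vanishes on functions harmonic near the hull *)

Section approximation.
Context {R : realType} {d : nat} (hd : (0 < d)%N).
Local Notation V := 'rV[R]_d.
Implicit Types (x y : V).
Context (O K : set V) (I : (V -> R) -> R).
Context (openO : open O) (cK : compact K) (KO : K `<=` O) (AI : annihilates O K I).
Local Notation L := (hull_in O K).

Lemma continuous_pts_shift (g : V -> R) y : continuous g ->
  continuous_at_pts K (fun x => g (x - y)).
Proof.
move=> cg x _; apply: (@continuous_comp _ _ _ (fun x => x - y) g).
  by apply: continuousB; [exact: cvg_id | exact: cst_continuous].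
exact: cg.
Qed.

Lemma kernel_potential_eq0 (E : V -> R) (e : R) y : 0 < e -> continuous E ->
  (forall x, e <= `|x| -> E x = ev x Efund) ->
  (forall a, L a -> e <= `|a - y|) -> I (fun x => E (x - y)) = 0.
Proof.
move=> e0 cE EE ye.
have Ly : ~ L y by move=> /ye; rewrite subrr normr0 leNgt e0.
have Ky : ~ K y by move=> Ky; apply: Ly; left.
rewrite -(vanish_off_hull hd openO cK KO AI Ly).
apply: (eq_annih AI); first exact: continuous_pts_shift.
- exact: cont_ev_pts.
- by move=> x Kx; apply: EE; apply: ye; left.
Qed.

Lemma sdiff_potential (E : V -> R) (h : R) y : continuous E ->
  sdiff h (fun y => I (fun x => E (x - y))) y = I (fun x => sdiff h E (x - y)).
Proof.
move=> cE; rewrite /sdiff.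
have cs z : continuous_at_pts K (fun x => E (x - z)) by exact: continuous_pts_shift.
have cs2 z : continuous_at_pts K (fun x => 2 * E (x - z)).
  by move=> x Kx; apply: continuousM; [exact: cst_continuous | exact: cs].
have csD z t : continuous_at_pts K (fun x => E (x - z) + E (x - t)).
  by move=> x Kx; apply: (@continuousD R R^o); exact: cs.
have -> : (fun x => \sum_(i < d) (E (x - y + h *: delta_mx 0 i)
      + E (x - y - h *: delta_mx 0 i) - 2 * E (x - y))) =
    (fun x => \sum_(i < d) ((E (x - (y - h *: delta_mx 0 i))
      + E (x - (y + h *: delta_mx 0 i))) - 2 * E (x - y))).
  apply/funext => x; apply: eq_bigr => i _.
  by rewrite (opprB y) (opprD y) (addrC (_ *: _) (- y)) !addrA.
rewrite (annih_sum AI) => [|i]; last exact: continuous_pts_sub.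
apply: eq_bigr => i _.
rewrite (annihB AI)// (annihD AI)// (annihZ AI)//.
by rewrite [X in X - _]addrC.
Qed.

Context (U : set V) (openU : open U) (LU : L `<=` U).
Context (f : V -> R) (har_f : har_open U f).

Lemma continuous_har x : U x -> {for x, continuous f}.
Proof. by have [[+ _] _] := har_f; apply. Qed.

(* Lattice points are indexed by [q], and [h = rho / q] is the mesh; the error
   terms are relative to the total mass [s0'] of the sampled kernel, which grows
   like the number [n0] of lattice points. *)
Lemma annih_osc (C w : R) : 0 <= C ->
  (forall f M, continuous_at_pts K f -> 0 <= M ->
     (forall x, K x -> `|f x| <= M) -> `|I f| <= C * M) ->
  0 < w -> `|I f| <= C * w.
Proof.
move=> C0 Cb w0.
have KL : K `<=` L by move=> x Kx; left.
have cL : compact L by exact: compact_hull_in.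
have [r0 r0_gt0 r0U] := compact_thickening cL openU LU.
(* Half of [r0], so that the closure [A] of the [r]-neighbourhood [A0] of the hull still lies in
   [U]. *)
pose r := r0 / 2; have r_gt0 : 0 < r by rewrite divr_gt0.
pose A0 : set V := [set t | exists2 a, L a & `|t - a| < r].
pose A := closure A0.
have LA0 : L `<=` A0 by move=> x Lx; exists x => //; rewrite subrr normr0.
have A0A : A0 `<=` A by exact: subset_closure.
have AU : A `<=` U.
  move=> t At; have [t' [[a La t'a] tt']] := At _ (nbhsx_ballx t r r_gt0).
  apply: (r0U a) => //; move: tt'; rewrite -ball_normE /= => tt'.
  have := ler_distD t' t a; rewrite /r in t'a tt' *; lra.
have [NL NL0 LN] := compact_norm_bound cL.
pose NA := NL + r; have NA0 : 0 < NA by rewrite addr_gt0.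
have A0N t : A0 t -> `|t| <= NA.
  move=> [a /LN aN ta]; have := ler_normD (t - a) a; rewrite subrK /NA; lra.
have cA : compact A.
  apply: bounded_closed_compact; last exact: closed_closure.
  exists NA; split; first exact: num_real.
  move=> M NM t At /=; rewrite leNgt; apply/negP => tM.
  have : \forall s \near t, NA < `|s|.
    apply: (@cvgr_norm_gt _ _ _ (nbhs t) _ id t); first exact: cvg_id.
    exact: lt_trans tM.
  by move=> /At[s [/A0N sN]]; rewrite ltNge sN.
have cf x : A x -> {for x, continuous f} by move=> /AU; exact: continuous_har.
have [Mf Mf0 fM] := bounded_on_compact cA cf.
have cfK : continuous_at_pts K f by move=> x Kx; apply: cf; apply/A0A/LA0/KL.
have [e1 e1_gt0 fe1] := unif_continuous_compact cK cfK w0.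
(* [e <= e1] makes [f] vary by less than [w] on the support of the kernel; [e <= r/2] leaves room in
   [A0] for a mesh step from any point within [e] of the hull. *)
pose e := Num.min e1 (r / 2).
have e_gt0 : 0 < e by rewrite lt_min e1_gt0 divr_gt0.
have ee1 : e <= e1 by rewrite ge_min lexx.
have er : e <= r / 2 by rewrite ge_min lexx orbT.
have [E [C2E EE psi_ge0 psi0 [m [rho [m0 rho0 psi_m]]]]] := regularized_kernel hd e_gt0.
set psi := laplacian E in psi_ge0 psi0 psi_m.
have cE : continuous E by move=> x; have [+ _] := C2E; apply.
have cpsi : continuous psi.
  move=> x; apply: continuous_sum_at => i.
  by have [_ /(_ i)[_ [_ /(_ i)[_ [+ _]]]]] := C2E; apply.
(* The cube will have half-side [rho * Q] for every mesh [rho / q]; it contains [A0] with a margin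
   for the kernel radius and a mesh step. *)
have [Q rQ] : exists Q : nat, NA + e + rho + 1 <= rho * Q%:R.
  exists (Num.truncn ((NA + e + rho + 1) / rho)).+1.
  rewrite mulrC -ler_pdivrMr//; apply: ltW; exact: truncnS_gt.
have Q0 : (0 < Q)%N.
  rewrite lt0n; apply/eqP => Q0; move: rQ; rewrite Q0 mulr0.
  by rewrite leNgt !addr_gt0.
pose Bn := 2 * NA + rho * Q%:R.
pose B : set V := [set x | `|x| <= Bn].
have cB : compact B.
  apply: bounded_closed_compact.
    by exists Bn; split; [exact: num_real | move=> M /ltW BM x /= /le_trans; apply].
  apply: (@closed_comp _ _ (fun x : V => `|x|) [set t : R | t <= Bn]).
    by move=> x _; exact: norm_continuous.
  exact: closed_le.
have [ME ME0 EM] := bounded_on_compact cB (fun x _ => cE x).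
(* Mesh-independent bound for the number of lattice points over the sampled mass: at most
   [(3 q Q)^d] points against a mass of at least [m q^d]. *)
pose Lam := (3 * Q%:R) ^+ d / m.
have Lam0 : 0 <= Lam by rewrite divr_ge0 ?exprn_ge0 ?mulr_ge0// ltW.
suff main (s : R) : 0 < s -> `|I f| <= C * w + s * (Lam * (C * (2 * w + 3 * Mf + ME))).
  apply/ler_addgt0Pr => t t0.
  set X := Lam * _ in main; have X0 : 0 <= X.
      by apply: mulr_ge0 => //; apply: mulr_ge0 => //; lra.
  have s0 : 0 < t / (X + 1) by rewrite divr_gt0// ltr_wpDl.
  apply: (le_trans (main _ s0)); rewrite lerD2l -mulrAC ler_pdivrMr ?ltr_wpDl//.
  by rewrite ler_wpM2l ?(ltW t0)// lerDl.
move=> s0.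
have [h1 h1_gt0 sf] := sdiff_laplacian hd openU cA AU har_f.1 s0.
have [h2 h2_gt0 sE] := sdiff_laplacian hd openT cB (fun _ _ => Logic.I) C2E s0.
have [h3 h3_gt0 spsi] := unif_continuous_compact cB (fun x _ => cpsi x) s0.
pose hm := Num.min (Num.min h1 h2) (Num.min h3 (Num.min (r / 2) rho)).
have hm0 : 0 < hm by rewrite !lt_min h1_gt0 h2_gt0 h3_gt0 rho0 divr_gt0.
pose q := (Num.truncn (rho / hm)).+1.
have q0 : 0 < q%:R :> R by rewrite ltr0n.
pose h := rho / q%:R.
have h0 : 0 < h by rewrite divr_gt0.
have hq : h * q%:R = rho by rewrite /h divfK// gt_eqF.
have hhm : h < hm.
  by rewrite /h ltr_pdivrMr// mulrC -ltr_pdivrMr//; exact: truncnS_gt.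
have [[hh1 hh2] [hh3 [hr hrho]]] : (h < h1 /\ h < h2) /\ (h < h3 /\ h < r / 2 /\ h < rho).
  by move: hhm; rewrite !lt_min => /andP[/andP[-> ->] /andP[-> /andP[-> ->]]].
set N := (q * Q)%N.
have hN : h * N%:R = rho * Q%:R by rewrite /N natrM mulrA hq.
pose J := {ffun 'I_d -> 'I_(N.*2.+1)}.
pose pt : J -> V := @lpt R d N h.
pose p y := I (fun x => E (x - y)).
(* A discontinuous cutoff: its jump is seen only at lattice points where [p] is zero. *)
pose F y := if pselect (A0 y) then f y else 0.
pose n0 : R := #|{: J}|%:R.
have n0_ge0 : 0 <= n0 by rewrite ler0n.
have FM y : `|F y| <= Mf.
  rewrite /F; case: (pselect (A0 y)) => [A0y|nA0y] /=; last by rewrite normr0.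
  exact/fM/A0A.
have FE y : A0 y -> F y = f y by rewrite /F; case: (pselect (A0 y)).
have F0 y : h * N%:R <= `|y| + h -> F y = 0.
  rewrite /F; case: (pselect (A0 y)) => [A0y|//]; have yN := A0N _ A0y; rewrite hN => h5.
  by exfalso; move: rQ yN h5 hrho e_gt0; lra.
have KN x : K x -> `|x| <= NA by move=> /KL/LA0/A0N.
have pM y : A0 y -> `|p y| <= C * ME.
  move=> /A0N yN; apply: Cb => //; first exact: continuous_pts_shift.
  move=> x /KN xN; apply: EM; rewrite /B /= /Bn.
  have : 0 <= rho * Q%:R by rewrite mulr_ge0// ltW.
  have := ler_normB x y; lra.
have step_a : `|\sum_j p (pt j) * sdiff h F (pt j)| <= n0 * (C * ME * (s * h ^+ 2)).
  apply: (le_trans (ler_norm_sum _ _ _)).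
  apply: (@le_trans _ _ (\sum_(j : J) (C * ME * (s * h ^+ 2)))); last first.
    by rewrite sumr_const mulr_natl.
  apply: ler_sum => j _.
  (* Far from the hull [p] vanishes. Otherwise the whole stencil lies in [A0], where [F] is [f] and
     its second difference is small. *)
  have [[a [La ay]]|far] := pselect (exists a, L a /\ `|a - pt j| < e); last first.
    rewrite /p (@kernel_potential_eq0 E e) ?mul0r ?normr0//.
      by rewrite !mulr_ge0// ?exprn_ge0// ltW.
    by move=> a La; rewrite leNgt; apply/negP => h5; apply: far; exists a.
  have A0y : A0 (pt j) by exists a => //; rewrite distrC; lra.
  have near_y t : `|t| <= h -> A0 (pt j + t).
    move=> th; exists a => //; have := ler_normD (pt j - a) t.
    rewrite addrAC [`|pt j - a|]distrC; lra.
  have -> : sdiff h F (pt j) = sdiff h f (pt j).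
    have nd i : `|h *: delta_mx 0 i : V| <= h.
      by rewrite (le_trans (norm_scale_delta _ _))// gtr0_norm.
    by apply: eq_bigr => i _; rewrite !FE//; apply: near_y; rewrite ?normrN.
  rewrite normrM; apply: ler_pM => //; first exact: pM.
  have := sf h (pt j) h0 hh1 (A0A _ A0y).
  by rewrite har_f.2 ?mulr0 ?subr0//; apply/AU/A0A.
have parts := @lattice_parts R d N h h0 p F F0.
have ptN j : `|pt j| <= rho * Q%:R by rewrite -hN; exact: norm_lpt.
have cont_psi y : continuous_at_pts K (fun x => psi (x - y)).
  exact: continuous_pts_shift.
have step_d j : `|sdiff h p (pt j) - h ^+ 2 * I (fun x => psi (x - pt j))|
    <= C * (s * h ^+ 2).
  have csd : continuous_at_pts K (fun x => sdiff h E (x - pt j)).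
    have cEs (v : V) : continuous (fun x => E (x + v)).
      move=> x; apply: (@continuous_comp _ _ _ (fun x => x + v) E); last exact: cE.
      by apply: continuousD; [exact: cvg_id | exact: cst_continuous].
    apply: (@continuous_pts_shift (sdiff h E)) => x.
    apply: continuous_sum_at => i.
    apply: (@continuousB R R^o).
      by apply: (@continuousD R R^o); exact: cEs.
    by apply: continuousM; [exact: cst_continuous | exact: cE].
  have cps : continuous_at_pts K (fun x => h ^+ 2 * psi (x - pt j)).
    by move=> x Kx; apply: continuousM; [exact: cst_continuous | exact: cont_psi].
  rewrite sdiff_potential// -(annihZ AI)// -(annihB AI)//; apply: Cb.
  - exact: continuous_pts_sub.
  - by rewrite mulr_ge0 ?exprn_ge0// ltW.
  move=> x /KN xN; apply: sE => //; rewrite /B /= /Bn.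
  have := ptN j; have := ler_normB x (pt j); lra.
pose T x := \sum_j F (pt j) * psi (x - pt j).
have cT1 j : continuous_at_pts K (fun x => F (pt j) * psi (x - pt j)).
  by move=> x Kx; apply: continuousM; [exact: cst_continuous | exact: cont_psi].
have cT : continuous_at_pts K T by exact: continuous_pts_sum.
have step_e : I T = \sum_j F (pt j) * I (fun x => psi (x - pt j)).
  by rewrite (annih_sum AI)//; apply: eq_bigr => j _; rewrite (annihZ AI).
have h2_gt : 0 < h ^+ 2 by rewrite exprn_gt0.
have step_T : `|I T| <= n0 * s * (C * (ME + Mf)).
  rewrite -(ler_pM2l h2_gt) -{1}(gtr0_norm h2_gt) -normrM step_e mulr_sumr.
  (* After summation by parts, replacing [sdiff h p] by [h^2] times the functional of the shifted
     [psi] leaves only the error controlled by [step_d]. *)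
  have -> : \sum_j h ^+ 2 * (F (pt j) * I (fun x => psi (x - pt j))) =
      \sum_j p (pt j) * sdiff h F (pt j)
      - \sum_j (sdiff h p (pt j) - h ^+ 2 * I (fun x => psi (x - pt j))) * F (pt j).
    rewrite parts -sumrB; apply: eq_bigr => j _; rewrite -/(pt j); ring.
  apply: (le_trans (ler_normB _ _)).
  have : `|\sum_j (sdiff h p (pt j) - h ^+ 2 * I (fun x => psi (x - pt j))) * F (pt j)|
      <= n0 * (C * (s * h ^+ 2) * Mf).
    apply: (le_trans (ler_norm_sum _ _ _)).
    apply: (@le_trans _ _ (\sum_(j : J) (C * (s * h ^+ 2) * Mf))); last first.
      by rewrite sumr_const mulr_natl.
    by apply: ler_sum => j _; rewrite normrM; apply: ler_pM.
  move=> h5; apply: (le_trans (lerD step_a h5)).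
  by rewrite le_eqVlt; apply/orP; left; apply/eqP; ring.
pose S x := \sum_j psi (x - pt j).
pose s0' : R := \sum_j psi (- pt j).
have Slow : m * (q ^ d)%:R <= s0'.
  apply: (@lattice_sum_lower R d N h h0 psi m rho q) => //.
    by rewrite /N leq_pmulr.
  by rewrite hq.
have Sconst x : K x -> `|S x - s0'| <= 2 * (n0 * s).
  move=> /KN xN; apply: (@lattice_sum_const R d N h h0 psi e psi0 NA s) => //.
  - exact: ltW.
  - exact: ltW.
  - by rewrite hN; move: rQ; lra.
  - move=> y t yN ty; apply/ltW/spsi; last exact: le_lt_trans hh3.
    by rewrite /B /= /Bn; move: yN; rewrite hN; lra.
(* [T] averages [f] with weights [psi (x - pt j)], all within [e] of [x]: the first error is the
   oscillation of [f], the second the variation of the total weight. *)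
have Tf x : K x -> `|T x - s0' * f x| <= w * (s0' + 2 * (n0 * s)) + 2 * (n0 * s) * Mf.
  move=> Kx; have Sc := Sconst x Kx.
  have -> : T x - s0' * f x = (T x - S x * f x) + (S x - s0') * f x by ring.
  apply: (le_trans (ler_normD _ _)); apply: lerD; last first.
    by rewrite normrM; apply: ler_pM => //; apply: fM; exact/A0A/LA0/KL.
  have Sle : S x <= s0' + 2 * (n0 * s).
    by move: Sc; rewrite ler_norml => /andP[_]; lra.
  apply: (@le_trans _ _ (w * S x)); last by rewrite ler_wpM2l// ltW.
  rewrite /T /S mulr_suml -sumrB mulr_sumr.
  apply: (le_trans (ler_norm_sum _ _ _)); apply: ler_sum => j _.
  have -> : F (pt j) * psi (x - pt j) - psi (x - pt j) * f x =
    (F (pt j) - f x) * psi (x - pt j) by ring.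
  rewrite normrM (ger0_norm (psi_ge0 _)).
  have [xe|xe] := leP e `|x - pt j|; first by rewrite psi0// !mulr0.
  apply: ler_wpM2r; first exact: psi_ge0.
  rewrite FE; last first.
    by exists x; [exact: KL | rewrite distrC; lra].
  by apply/ltW/fe1 => //; rewrite distrC; exact: lt_le_trans ee1.
have s0'_gt0 : 0 < s0'.
  by apply: lt_le_trans Slow; rewrite mulr_gt0// ltr0n expn_gt0.
have n0_le : n0 <= Lam * s0'.
  have : n0 <= (3 * Q%:R) ^+ d * (q ^ d)%:R.
    rewrite /n0 card_ffun !card_ord natrX [(q ^ d)%:R]natrX -exprMn.
    rewrite lerXn2r ?nnegrE ?mulr_ge0// -!natrM ler_nat /N.
    have : (0 < q * Q)%N by rewrite muln_gt0 Q0.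
    rewrite -mulnA [(Q * q)%N]mulnC; move: (q * Q)%N => n n_gt0.
    by rewrite !mulSn mul0n addn0 addnA -addnn -addn1 leq_add2l.
  move=> /le_trans; apply; rewrite /Lam mulrAC -mulrA ler_wpM2l ?exprn_ge0 ?mulr_ge0//.
  by rewrite ler_pdivlMr// mulrC.
have csf : continuous_at_pts K (fun x => s0' * f x).
  by move=> x Kx; apply: continuousM; [exact: cst_continuous | exact: cfK].
have IB : `|I T - s0' * I f| <= C * (w * (s0' + 2 * (n0 * s)) + 2 * (n0 * s) * Mf).
  rewrite -(annihZ AI)// -(annihB AI)//; apply: Cb => //.
    exact: continuous_pts_sub.
  by rewrite addr_ge0 ?mulr_ge0 ?addr_ge0 ?mulr_ge0// ltW.
rewrite -(ler_pM2l s0'_gt0) -{1}(gtr0_norm s0'_gt0) -normrM.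
have -> : s0' * I f = I T - (I T - s0' * I f) by rewrite opprB addrCA subrr addr0.
apply: (le_trans (ler_normB _ _)); apply: (le_trans (lerD step_T IB)).
have -> : n0 * s * (C * (ME + Mf)) +
    C * (w * (s0' + 2 * (n0 * s)) + 2 * (n0 * s) * Mf) =
  s0' * (C * w) + n0 * (s * (C * (2 * w + 3 * Mf + ME))) by ring.
set Y := C * (2 * w + 3 * Mf + ME).
have Y0 : 0 <= Y by apply: mulr_ge0 => //; lra.
rewrite [leRHS]mulrDr lerD2l.
have -> : s0' * (s * (Lam * Y)) = (Lam * s0') * (s * Y) by ring.
by apply: ler_wpM2r => //; rewrite mulr_ge0// ltW.
Qed.

Lemma annih_har_hull : I f = 0.
Proof.
have [C C0 Cb] := annih_bound AI.
apply/eqP; rewrite -normr_le0; apply/ler_addgt0Pr => t t0.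
have C1 : 0 < C + 1 by rewrite ltr_wpDl.
have := @annih_osc C (t / (C + 1)) C0 Cb (divr_gt0 t0 C1) => /le_trans; apply.
rewrite add0r mulrCA ler_piMr ?(ltW t0)// ler_pdivrMr// mul1r lerDl//.
Qed.

End approximation.

(** * Integration against charges *)

Section borel.
Context {R : realType} {d : nat}.
Local Notation V := 'rV[R]_d.
Implicit Types (A D U K : set V) (f g : V -> R).

Lemma open_borel U : open U -> measurable (U : set (borelRd R d)).
Proof. by move=> oU; apply: sub_sigma_algebra. Qed.

Lemma compact_borel K : compact K -> measurable (K : set (borelRd R d)).
Proof.
move=> /compact_closedV cK; rewrite -[K]setCK; apply: measurableC.
by apply: open_borel; exact: closed_openC.
Qed.

Lemma measurable_fun_borel D f : measurable (D : set (borelRd R d)) ->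
  (forall x, D x -> {for x, continuous f}) ->
  measurable_fun (D : set (borelRd R d)) f.
Proof.
move=> mD cf; apply: (measurability _ (RGenOpens.measurableE R)).
move=> _ [_ [a [b ->] <-]].
(* Continuity in the ambient space at the points of [D] lets the preimage be replaced by its
   interior, so [f] may be arbitrary off [D]. *)
have -> : D `&` f @^-1` `]a, b[%classic = D `&` interior (f @^-1` `]a, b[%classic).
  apply/seteqP; split=> x [Dx fx]; split => //; last exact: interior_subset.
  apply: (cf x Dx); apply: open_nbhs_nbhs; split => //; exact: interval_open.
by apply: measurableI => //; apply: open_borel; exact: open_interior.
Qed.

Lemma rational_ball x (r : R) : 0 < r -> exists (a : 'rV[rat]_d) (n : nat),
  ball (map_mx ratr a : V) (n.+1%:R^-1) x /\
  ball (map_mx ratr a : V) (n.+1%:R^-1) `<=` ball x r.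
Proof.
move=> r0; pose n := Num.truncn (2 / r).
have n0 : 0 < n.+1%:R^-1 :> R by rewrite invr_gt0.
have nr : n.+1%:R^-1 < r / 2.
  by rewrite -[r / 2]invf_div ltf_pV2 ?posrE ?divr_gt0//; exact: truncnS_gt.
have ex i : exists a : rat, `|x 0 i - ratr a| < n.+1%:R^-1.
  have : x 0 i - n.+1%:R^-1 < x 0 i + n.+1%:R^-1 by rewrite ltrD2l gtrN.
  move=> /rat_in_itvoo[a]; rewrite in_itv/= => /andP[a1 a2].
  exists a; move: (n.+1%:R^-1) a1 a2 => e a1 a2; rewrite ltr_norml; lra.
pose a : 'rV[rat]_d := \row_i sval (cid (ex i)).
have xa : `|x - map_mx ratr a| < n.+1%:R^-1.
  apply: norm_lt_coord => // i; rewrite !mxE; case: cid => /= q; exact.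
exists a, n; split; first by rewrite -ball_normE /= distrC.
move=> y; rewrite -!ball_normE /= => ay.
have := ler_distD (map_mx ratr a) x y.
move: (n.+1%:R^-1) nr xa ay => e nr xa ay; lra.
Qed.

Variable m : {measure set (borelRd R d) -> \bar R}.

(** Lindelof argument: the complement of [K] is covered by the null balls among countably many with
    rational centre and radius [1/(n+1)]. This turns the pointwise definition of the support into a
    null complement. *)
Lemma locally_null_null K : (forall x, ~ K x -> exists U, [/\ open U, U x & m U = 0%E]) ->
  m.-negligible (~` K).
Proof.
move=> loc.
pose B (q : 'rV[rat]_d * nat) : set V := ball (map_mx ratr q.1 : V) (q.2.+1%:R^-1).
have mB q : measurable (B q : set (borelRd R d)) by apply: open_borel; exact: ball_open.
pose F n : set V := if unpickle n is Some q then if m (B q) == 0%E then B q else set0 else set0.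
apply: (@negligibleS _ _ _ m (\bigcup_n F n)).
  move=> x /loc[U [oU Ux U0]].
  have /nbhs_ballP[r /= r0 rU] : nbhs x U by exact: open_nbhs_nbhs.
  have [a [n [ax aU]]] := rational_ball x r0.
  exists (pickle (a, n)) => //; rewrite /F pickleK ifT//.
  rewrite -measure_le0 -U0; apply: le_measure; rewrite ?inE//; first exact: open_borel.
  exact: subset_trans rU.
apply: negligible_bigcup => n; rewrite /F.
case: unpickle => [q|]; last exact: negligible_set0.
case: ifP => [/eqP Bq|_]; last exact: negligible_set0.
exact/negligibleP.
Qed.

Context (mfin : forall A, measurable (A : set (borelRd R d)) -> m A \is a fin_num).
Context (K : set V) (cK : compact K) (m0 : m (~` K) = 0%E).

Lemma integrable_on_compact f : continuous_at_pts K f ->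
  m.-integrable (K : set (borelRd R d)) (EFin \o f).
Proof.
move=> cf; have mK := compact_borel cK.
apply: measurable_bounded_integrable => //.
- by rewrite ltey_eq mfin.
- exact: measurable_fun_borel.
have cfK : compact (f @` K).
  apply: continuous_compact => //; apply: continuous_in_subspaceT => x.
  by rewrite inE => /cf.
have /compact_bounded[M [Mr fM]] := cfK.
by exists M; split => // N MN x Kx /=; apply: (fM _ MN); exists x.
Qed.

Lemma integral_supp D f : measurable (D : set (borelRd R d)) -> K `<=` D ->
  (forall x, D x -> {for x, continuous f}) ->
  (\int[m]_(x in D) (f x)%:E = \int[m]_(x in K) (f x)%:E)%E.
Proof.
move=> mD KD cf; have mK := compact_borel cK.
have mDK : measurable (D `\` K : set (borelRd R d)) by exact: measurableD.
have DK : D `\` (D `\` K) = K.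
  by rewrite setDD; apply/seteqP; split=> [x []//|x Kx]; split => //; exact: KD.
have mDK0 : m (D `\` K) = 0%E.
  apply/eqP; rewrite -measure_le0 -m0; apply: le_measure; rewrite ?inE//.
  exact: measurableC.
have /measurable_EFinP mf := measurable_fun_borel mD cf.
(* [f] may be unbounded on [D]; integrability is inherited from the compact [K], since [D] exceeds
   it by a null set. *)
have intf : m.-integrable (D : set (borelRd R d)) (fun x : borelRd R d => (f x)%:E).
  apply: (negligible_integrable mDK mD mf mDK0).2; rewrite DK.
  by apply: integrable_on_compact => x /KD; exact: cf.
by rewrite (negligible_integral mDK mD intf mDK0) DK.
Qed.

Lemma integral_fin D f : measurable (D : set (borelRd R d)) -> K `<=` D ->
  (forall x, D x -> {for x, continuous f}) ->
  (\int[m]_(x in D) (f x)%:E)%E = (\int[m]_(x in K) f x)%:E.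
Proof.
move=> mD KD cf; rewrite (integral_supp mD KD cf) fineK//.
apply: integrable_fin_num; first exact: compact_borel.
by apply: integrable_on_compact => x /KD; exact: cf.
Qed.

Lemma Rintegral_lin (a : R) f g : continuous_at_pts K f -> continuous_at_pts K g ->
  \int[m]_(x in K) (a * f x + g x) = a * \int[m]_(x in K) f x + \int[m]_(x in K) g x.
Proof.
move=> cf cg; have mK := compact_borel cK.
rewrite RintegralD//.
- by rewrite RintegralZl//; exact: integrable_on_compact.
- apply: integrable_on_compact => x Kx.
  by apply: continuousM; [exact: cst_continuous | exact: cf].
- exact: integrable_on_compact.
Qed.

Lemma Rintegral_bound f (M : R) : continuous_at_pts K f ->
  (forall x, K x -> `|f x| <= M) ->
  `|\int[m]_(x in K) f x| <= fine (m K) * M.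
Proof.
move=> cf fM; have mK := compact_borel cK.
have intf := integrable_on_compact cf.
apply: (le_trans (le_normr_Rintegral mK intf)).
rewrite mulrC -(Rintegral_cst m mK); apply: le_Rintegral => //.
- exact: integrable_norm.
- by apply: integrable_on_compact => x _; exact: cst_continuous.
Qed.

End borel.

Section charges.
Context {R : realType} {d : nat}.
Local Notation V := 'rV[R]_d.
Implicit Types (nu : {charge set borelRd R d -> \bar R}) (O K D : set V) (f : V -> R).

Lemma charge_pos_fin nu (A : set (borelRd R d)) : measurable A ->
  charge_pos nu A \is a fin_num.
Proof. by move=> mA; apply: (fin_num_measure (jordan_pos (hahn_pos_neg nu))). Qed.

Lemma charge_neg_fin nu (A : set (borelRd R d)) : measurable A ->
  charge_neg nu A \is a fin_num.
Proof. by move=> mA; apply: (fin_num_measure (jordan_neg (hahn_pos_neg nu))). Qed.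

Lemma off_charge_supp nu x : ~ charge_supp nu x -> exists U : set V,
  [/\ open U, U x, charge_pos nu U = 0%E & charge_neg nu U = 0%E].
Proof.
move=> /existsNP[U /not_implyP[oU /not_implyP[Ux /negP/negPn/eqP tv0]]].
exists U; move: tv0; rewrite /total_variation /charge_variation /= => /eqP.
by rewrite padde_eq0 => [/andP[/eqP p0 /eqP n0]|//|//].
Qed.

Lemma charge_parts_null nu K : compact K -> charge_supp nu `<=` K ->
  charge_pos nu (~` K) = 0%E /\ charge_neg nu (~` K) = 0%E.
Proof.
move=> cK nuK.
have mK : measurable (~` K : set (borelRd R d)).
  by apply: measurableC; exact: compact_borel.
by split; apply: measure_negligible => //; apply: locally_null_null => x Kx;
  have [|U [oU Ux p0 n0]] := @off_charge_supp nu x; [move=> /nuK | exists U |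
  move=> /nuK | exists U].
Qed.

Definition charge_Rintegral nu K f : R :=
  \int[charge_pos nu]_(x in K) f x - \int[charge_neg nu]_(x in K) f x.

Lemma charge_integralE nu K D f : compact K -> charge_supp nu `<=` K ->
  measurable (D : set (borelRd R d)) -> K `<=` D ->
  (forall x, D x -> {for x, continuous f}) ->
  charge_integral nu D f = (charge_Rintegral nu K f)%:E.
Proof.
move=> cK nuK mD KD cf; have [p0 n0] := charge_parts_null cK nuK.
rewrite /charge_integral (integral_fin (@charge_pos_fin nu) cK p0 mD KD cf).
by rewrite (integral_fin (@charge_neg_fin nu) cK n0 mD KD cf).
Qed.

Lemma charge_Rintegral_lin nu K (a : R) f g : compact K ->
  continuous_at_pts K f -> continuous_at_pts K g ->
  charge_Rintegral nu K (fun x => a * f x + g x) =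
  a * charge_Rintegral nu K f + charge_Rintegral nu K g.
Proof.
move=> cK cf cg; rewrite /charge_Rintegral.
rewrite (Rintegral_lin (@charge_pos_fin nu))// (Rintegral_lin (@charge_neg_fin nu))//.
ring.
Qed.

Lemma charge_Rintegral_bound nu K : compact K -> exists2 C, 0 <= C &
  forall f M, continuous_at_pts K f -> (forall x, K x -> `|f x| <= M) ->
    `|charge_Rintegral nu K f| <= C * M.
Proof.
move=> cK; exists (fine (charge_pos nu K) + fine (charge_neg nu K)).
  by rewrite addr_ge0// fine_ge0.
move=> f M cf fM; rewrite mulrDl; apply: (le_trans (ler_normB _ _)).
by apply: lerD; apply: Rintegral_bound => //; [exact: charge_pos_fin | exact: charge_neg_fin].
Qed.

Lemma Ck_onN k O f : open O -> Ck_on k O f -> Ck_on k O (fun x => - f x).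
Proof.
move=> oO; elim: k f => [|k IHk] f [cf df].
  by split=> // x Ox; apply: (@continuousN R R^o); exact: cf.
split=> [x Ox|i]; first by apply: (@continuousN R R^o); exact: cf.
have [di ci] := df i; split=> [x Ox|]; first by apply: derivableN; exact: di.
apply: Ck_on_ext (IHk _ ci) => // x Ox.
by rewrite /partial deriveN//; exact: di.
Qed.

Lemma har_openN O f : open O -> har_open O f -> har_open O (fun x => - f x).
Proof.
move=> oO [Cf Lf]; split; first exact: Ck_onN.
move=> x Ox; rewrite -[RHS]oppr0 -(Lf x Ox) /laplacian -sumrN.
apply: eq_bigr => i _.
have [di [_ /(_ i)[dii _]]] := Cf.2 i.
rewrite {1}/partial (@near_eq_derive _ _ _ _ (fun y => - partial i f y)).
  by rewrite deriveN//; exact: dii.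
by apply: filterS (open_near oO Ox) => y Oy; rewrite /partial deriveN//; exact: di.
Qed.

End charges.

Theorem theorem5 (R : realType) (d : nat) (hd : (1 <= d)%N)
    (O : set 'rV[R]_d) (openO : open O) (O0 : O !=set0) (greenO : greenian O)
    (theta mu : {charge set borelRd R d -> \bar R})
    (ctheta : compact (charge_supp theta)) (thetaO : charge_supp theta `<=` O)
    (cmu : compact (charge_supp mu)) (muO : charge_supp mu `<=` O)
    (bal : balayage O theta mu (har_open O)) :
  let L := hull_in O (charge_supp mu `|` charge_supp theta) in
  forall h : 'rV[R]_d -> R, har L h ->
    charge_integral theta L h = charge_integral mu L h.
Proof.
set K := charge_supp mu `|` charge_supp theta => L h [U [oU LU [f har_f hf]]].
have cK : compact K by exact: compactU.
have KO : K `<=` O by move=> x [/muO|/thetaO].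
have KL : K `<=` L by move=> x Kx; left.
have cL : compact L by exact: compact_hull_in.
have thK : charge_supp theta `<=` K by move=> x; right.
have muK : charge_supp mu `<=` K by move=> x; left.
pose I g := charge_Rintegral mu K g - charge_Rintegral theta K g.
have I_lin a g1 g2 : continuous_at_pts K g1 -> continuous_at_pts K g2 ->
    I (fun x => a * g1 x + g2 x) = a * I g1 + I g2.
  by move=> c1 c2; rewrite /I !charge_Rintegral_lin//; ring.
have har_cont (W : set 'rV[R]_d) g x : har_open W g -> W x -> {for x, continuous g}.
  by move=> [[+ _] _]; apply.
have I_ge0 g : har_open O g -> 0 <= I g.
  move=> hg; have := bal g hg.
  have cg x : O x -> {for x, continuous g} by exact: har_cont.
  rewrite (charge_integralE cK thK (open_borel openO) KO cg).
  rewrite (charge_integralE cK muK (open_borel openO) KO cg).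
  by rewrite lee_fin subr_ge0.
have AI : annihilates O K I.
  split => //.
  - have [C1 C10 b1] := charge_Rintegral_bound mu cK.
    have [C2 C20 b2] := charge_Rintegral_bound theta cK.
    exists (C1 + C2); first exact: addr_ge0.
    move=> g M cg M0 gM; rewrite mulrDl; apply: (le_trans (ler_normB _ _)).
    by apply: lerD; [exact: b1 | exact: b2].
  - move=> g hg; apply/eqP; rewrite eq_le I_ge0// andbT -oppr_ge0.
    have cg : continuous_at_pts K g by move=> x /KO; exact: har_cont.
    have c0 : continuous_at_pts K (fun=> 0 : R) by move=> x _; exact: cst_continuous.
    have I0 : I (fun=> 0) = 0.
      by have := I_lin (-1) _ _ c0 c0; rewrite mulr0 addr0 mulN1r addNr.
    have := I_lin (-1) g _ cg c0; rewrite I0 addr0 mulN1r => <-.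
    rewrite (_ : (fun x => _) = (fun x => - g x)); last first.
      by apply/funext => x; rewrite mulN1r addr0.
    by apply: I_ge0; exact: har_openN.
have If : I f = 0 by exact: (annih_har_hull hd openO cK KO AI oU LU har_f).
have cf x : L x -> {for x, continuous f} by move=> /LU; exact: har_cont.
(* [h] is constrained on [L] only and need not be continuous in the ambient space there; the
   integrals over [L] allow passing to [f]. *)
have ci (nu : {charge set borelRd R d -> \bar R}) : charge_integral nu L h = charge_integral nu L f.
  rewrite /charge_integral; congr (_ - _)%E; apply: eq_integral => x;
  by rewrite inE => /hf ->.
rewrite !ci (charge_integralE cK thK (compact_borel cL) KL cf).
rewrite (charge_integralE cK muK (compact_borel cL) KL cf).
by congr _%:E; apply/eqP; rewrite eq_sym -subr_eq0; apply/eqP.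
Qed.
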